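(* Let $0<T<\infty$, let $\mathcal W=\{1,\ldots,w\}$ be a finite state space, and let $\gamma_0=\{\gamma_0(j,k)\}$ be a known $w\times w$ matrix (with zeroes on the diagonal) of transition probabilities; there may be an absorbing state. Let $\theta=(\alpha,\beta)$ range over all pairs consisting of a distribution $\alpha$ of the initial state on $\mathcal W$ and a vector $\beta$ of rates, and let $f(\cdot;(\alpha,\beta),\gamma_0)$ be the density, given in the context, of the sample path over $(0,T]$ of the corresponding continuous-time Markov chain. Let $(\alpha_0,\beta_0)$ be a known parameter value, and suppose the null hypothesis of one component holds, that is, $\boldsymbol X_1,\boldsymbol X_2,\ldots$ are independent sample paths with common density $f(\cdot;(\alpha_0,\beta_0),\gamma_0)$. Then the log-likelihood ratio statistic for testing between one and two components, $$\Lambda_n^s=\sup_{0\le p\le 1,\ (\alpha,\beta)}\ \sum_{i=1}^n\log\left[(1-p)f(\boldsymbol X_i;(\alpha_0,\beta_0),\gamma_0)+p f(\boldsymbol X_i;(\alpha,\beta),\gamma_0)\right]-\sum_{i=1}^n\log f(\boldsymbol X_i;(\alpha_0,\beta_0),\gamma_0),$$ tends to infinity in probability as $n\to\infty$; that is, $P\{\Lambda_n^s\le M\}\to0$ for each $0<M<\infty$.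
   Context: Parametrisation. A stationary (time-homogeneous) continuous-time Markov chain on $\mathcal W$, observed over $(0,T]$, is described by: $\alpha=\{\alpha(j)\colon j=1,\ldots,w\}$, the vector of probabilities describing the distribution of the initial state; $\beta=\{\beta(j)=\beta_j\colon j=1,\ldots,w\}$, the vector of rates determining the average time the process stays in each state (sojourn times in state $j$ are exponential with rate $\beta_j$, conditionally independent given the sequence of visited states); and $\gamma=\{\gamma(j,k)=\gamma_{j,k}\colon j,k=1,\ldots,w\}$, the matrix (with zeroes on the diagonal) of transition probabilities governing movements between states, given that a transition occurs. A state is absorbing if the chain never leaves it once entered. The two mixture components may have different $(\alpha,\beta)$ but share the same $\gamma=\gamma_0$. Sample paths. A realisation $\boldsymbol x(\cdot)$ over $(0,T]$ is a step function characterised by pairs $(z_0,t_0),\ldots,(z_m,t_m)$, $m\ge0$: the process spends time $t_0\le T$ in the initial state $z_0$; if $t_0<T$ it transitions to a state $z_1\ne z_0$ and spends time $t_1\le T-t_0$ there; and so on until $t_0+\cdots+t_m=T$, the last sojourn being truncated at time $T$. Write $\tau_j=\sum_{i=0}^m t_i1\{z_i=j\}$ for the total time spent in state $j$ and, if $m>0$, $n_{jk}=\sum_{i=1}^m1\{z_{i-1}=j,z_i=k\}$ for the number of transitions from $j$ to $k$. Density. With respect to the usual dominating measure on such paths (the sum, over all $m\ge0$ and all state sequences $z_0,\ldots,z_m$, of Lebesgue measure in $(t_0,\ldots,t_{m-1})$, with a unit point mass for each $z_0$ when $m=0$), the density is $$f(\boldsymbol x(\cdot);(\alpha,\beta),\gamma)=\alpha(z_0)e^{-\beta(z_0)T}\quad\text{if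 } m=0,$$ $$f(\boldsymbol x(\cdot);(\alpha,\beta),\gamma)=\alpha(z_0)\prod_{j=1}^w e^{-\beta_j\tau_j}\prod_{k\colon\gamma_{j,k}>0}\beta_j^{n_{jk}}\gamma_{j,k}^{n_{jk}}\quad\text{if } m>0 \text{ and } \sum_{j=0}^m t_j=T,$$ and $0$ otherwise. The restriction of the second product to indices $k$ with $\gamma_{j,k}>0$ accounts both for the zero diagonal elements of $\gamma$ and for the case when any of the states are absorbing (transitions $j\to k$ with $\gamma_{j,k}=0$ do not occur).
   Formalization: The formal theorem adds that some state j has α_0(j)>0 and β_0(j)>0, so transitions occur with positive probability under the null; otherwise (e.g. α_0 concentrated on an absorbing state) the statistic stays bounded in probability and the claim fails. *)

(* Defs.v *)
From HB Require Import structures.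
From mathcomp Require Import all_boot all_order all_algebra.
From mathcomp Require Import all_classical all_reals all_analysis.
From mathcomp Require Import measurable_realfun.

Set Implicit Arguments.
Unset Strict Implicit.
Unset Printing Implicit Defensive.

Import Order.TTheory GRing.Theory Num.Theory.
Import numFieldNormedType.Exports.

Local Open Scope classical_set_scope.
Local Open Scope ring_scope.

Section image_measure.
Local Open Scope ereal_scope.
Context d1 d2 (T1 : measurableType d1) (T2 : measurableType d2) (R : realType).
Variables (mu : {measure set T1 -> \bar R}) (f : {mfun T1 >-> T2}).

Definition image_measure : set T2 -> \bar R := pushforward mu f.

Let image_measure0 : image_measure set0 = 0.
Proof. by rewrite /image_measure /pushforward preimage_set0 measure0. Qed.

Let image_measure_ge0 A : 0 <= image_measure A.
Proof. exact: measure_ge0. Qed.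

Let image_measure_sigma_additive : semi_sigma_additive image_measure.
Proof.
exact: (@measure_semi_sigma_additive _ _ _
  (measure_function_pushforward__canonical__measure_function_Measure
    mu (@measurable_funPT _ _ _ _ f))).
Qed.

HB.instance Definition _ := isMeasure.Build _ _ _ image_measure
  image_measure0 image_measure_ge0 image_measure_sigma_additive.

End image_measure.

(* The library has no Lebesgue measure on R^m; it is built here by induction
   on m from products with the Lebesgue measure on the line. *)
Section lebesgue_tuple.
Local Open Scope ereal_scope.
Context {R : realType}.
Local Notation borelR := (measurableTypeR R).

Definition cons_pair (m : nat) (p : m.-tuple borelR * borelR) :
    m.+1.-tuple borelR :=
  [tuple of p.2 :: p.1].

Lemma measurable_cons_pair (m : nat) :
  measurable_fun [set: m.-tuple borelR * borelR] (@cons_pair m).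
Proof. exact: measurable_cons. Qed.

HB.instance Definition _ (m : nat) :=
  isMeasurableFun.Build _ _ _ _ (@cons_pair m) (@measurable_cons_pair m).

Fixpoint lebesgue_tuple (m : nat) : {measure set (m.-tuple borelR) -> \bar R} :=
  if m is m'.+1 then
    image_measure (lebesgue_tuple m' \x @lebesgue_measure R) (@cons_pair m')
  else \d_[tuple].

End lebesgue_tuple.

(* A path over (0, T] is the sequence (z_0, t_0), ..., (z_m, t_m) of the
   visited states and sojourn times, the last sojourn being truncated at T. *)
Definition sample_path (w : nat) (R : realType) := seq ('I_w * R).

Section sample_path_measurable.
Context {w : nat} {R : realType}.
Local Notation borelR := (measurableTypeR R).
Local Notation path := (sample_path w R).

HB.instance Definition _ := Choice.copy path (seq ('I_w * R)).
HB.instance Definition _ := isPointed.Build path [::].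

(* Paths are measured through the times, separately for each state sequence:
   every sequence of pairs is zip z t for exactly one pair z, t. *)
Definition path_measurable : set (set path) :=
  [set A | forall (m : nat) (z : m.-tuple 'I_w),
     measurable [set t : m.-tuple borelR | A (zip z t)]].

Let path_measurable0 : path_measurable set0.
Proof. by move=> m z; exact: measurable0. Qed.

Let path_measurableC A : path_measurable A -> path_measurable (~` A).
Proof. by move=> mA m z; exact: measurableC (mA m z). Qed.

Let path_measurable_bigcup (F : (set path)^nat) :
  (forall i, path_measurable (F i)) -> path_measurable (\bigcup_i F i).
Proof. by move=> mF m z; apply: bigcupT_measurable => i; exact: mF. Qed.

HB.instance Definition _ := @isMeasurable.Build default_measure_display path
  path_measurable path_measurable0 path_measurableC path_measurable_bigcup.

End sample_path_measurable.

Section path_measure.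
Local Open Scope ereal_scope.
Context {w : nat} {R : realType} (T : R).
Local Notation borelR := (measurableTypeR R).
Local Notation path := (sample_path w R).

Definition mk_path (m : nat) (z : m.+1.-tuple 'I_w) (t : m.-tuple borelR) : path :=
  zip z (rcons t (T - \sum_(s <- t) s)%R).

Lemma measurable_mk_path (m : nat) (z : m.+1.-tuple 'I_w) :
  measurable_fun [set: m.-tuple borelR] (mk_path z).
Proof.
move=> _ A mA; rewrite setTI.
pose g (t : m.-tuple borelR) : m.+1.-tuple borelR :=
  [tuple of rcons t (T - \sum_(s <- t) s)%R].
have mg : measurable_fun [set: m.-tuple borelR] g.
  apply/measurable_fun_tnthP => i.
  have [im|mi] := ltnP i m.
    rewrite (_ : _ \o _ = (@tnth _ R ^~ (Ordinal im))).
      exact: measurable_tnth.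
    apply/funext => t /=.
    by rewrite !(tnth_nth 0%R) /= nth_rcons size_tuple im.
  rewrite (_ : _ \o _ = fun t => (T - \sum_(j < m) tnth t j)%R).
    apply: measurable_funB => //.
    by apply: measurable_sum => j; exact: measurable_tnth.
  apply/funext => t /=; rewrite (tnth_nth 0%R) /= nth_rcons size_tuple.
  have -> : nat_of_ord i = m by apply/eqP; rewrite eqn_leq mi -ltnS ltn_ord.
  by rewrite ltnn eqxx big_tuple.
by have := mg measurableT _ (mA _ z); rewrite setTI.
Qed.

HB.instance Definition _ (m : nat) (z : m.+1.-tuple 'I_w) :=
  isMeasurableFun.Build _ _ _ _ (mk_path z) (measurable_mk_path z).

(* For m = 0 the inner summand is the unit point mass at the path (z_0, T). *)
Definition path_measure (A : set path) : \bar R :=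
  \sum_(0 <= m <oo) \sum_(z : m.+1.-tuple 'I_w)
    image_measure (@lebesgue_tuple R m) (mk_path z) A.

Let path_measure0 : path_measure set0 = 0.
Proof.
by rewrite /path_measure eseries0// => m _ _; rewrite big1// => z _;
   exact: measure0.
Qed.

Let path_measure_ge0 A : 0 <= path_measure A.
Proof. by apply: nneseries_ge0 => m _ _; apply: sume_ge0 => z _. Qed.

Let path_measure_sigma_additive : semi_sigma_additive path_measure.
Proof.
move=> F mF tF mUF.
rewrite [X in _ --> X](_ : _ =
    lim ((fun n => \sum_(0 <= i < n) path_measure (F i)) @ \oo)).
  by apply: is_cvg_ereal_nneg_natsum => k _; exact: path_measure_ge0.
rewrite nneseries_interchange.
  apply: eq_eseriesr => m _; rewrite nneseries_sum//.
  by apply: eq_bigr => z _; apply: measure_semi_bigcup.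
by move=> i m; apply: sume_ge0.
Qed.

HB.instance Definition _ := isMeasure.Build _ _ _ path_measure
  path_measure0 path_measure_ge0 path_measure_sigma_additive.

End path_measure.

Section model.
Context {w : nat} {R : realType}.
Local Notation path := (sample_path w R).
Implicit Types (T : R) (gamma : 'M[R]_w) (theta : ('I_w -> R) * ('I_w -> R)).
Implicit Types (x : path) (j k : 'I_w).

(* A row of zeroes is that of an absorbing state, from which no transition
   occurs. *)
Definition is_transition gamma : Prop :=
  [/\ forall j k, 0 <= gamma j k,
      forall j, gamma j j = 0 &
      forall j, \sum_k gamma j k = 1 \/ forall k, gamma j k = 0].

Definition is_distribution (alpha : 'I_w -> R) : Prop :=
  (forall j, 0 <= alpha j) /\ \sum_j alpha j = 1.

(* The rate is 0 when the sojourn is infinite; this is forced on absorbing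
   states, as otherwise the density below would not have total mass 1. *)
Definition is_rate gamma (beta : 'I_w -> R) : Prop :=
  forall j, 0 <= beta j /\ ((forall k, gamma j k = 0) -> beta j = 0).

Definition is_param gamma theta : Prop :=
  is_distribution theta.1 /\ is_rate gamma theta.2.

Definition sojourn x j : R := \sum_(e <- x | e.1 == j) e.2.

Definition transitions x j k : nat :=
  count (fun e => (e.1.1 == j) && (e.2.1 == k)) (zip x (behead x)).

(* The transitions j -> k with gamma j k = 0, in particular j -> j, do not
   occur. *)
Definition is_path T gamma x : bool :=
  [&& all (fun e => 0 < e.2) x, \sum_(e <- x) e.2 == T &
      sorted (fun j k => 0 < gamma j k) [seq e.1 | e <- x]].

Definition path_density T gamma theta x : R :=
  let: (alpha, beta) := theta in
  if is_path T gamma x then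
    match x with
    | [::] => 0
    | [:: e] => alpha e.1 * expR (- (beta e.1 * T))
    | e :: _ => alpha e.1 *
        \prod_j (expR (- (beta j * sojourn x j)) *
          \prod_(k | 0 < gamma j k)
            (beta j ^+ transitions x j k * gamma j k ^+ transitions x j k))
    end
  else 0.

Local Open Scope ereal_scope.

(* lne is the logarithm with values in [-oo, +oo], lne 0 = -oo. *)
Definition mixture_loglik T gamma theta0 (n : nat) (x : nat -> path)
    (p : R) theta : \bar R :=
  \sum_(i < n) lne ((1 - p) * path_density T gamma theta0 (x i) +
                    p * path_density T gamma theta (x i))%:E.

Definition loglik_ratio T gamma theta0 (n : nat) (x : nat -> path) : \bar R :=
  ereal_sup [set mixture_loglik T gamma theta0 n x q.1 q.2 |
             q in [set q : R * (('I_w -> R) * ('I_w -> R)) |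
                   (0 <= q.1 <= 1)%R /\ is_param gamma q.2]] -
  \sum_(i < n) lne (path_density T gamma theta0 (x i))%:E.

End model.

Section sampling.
Local Open Scope ereal_scope.
Context d d' (Omega : measurableType d) (U : measurableType d').
Context (R : realType) (P : probability Omega R).

Definition independent_seq (X : nat -> {RV P >-> U}) : Prop :=
  forall (s : seq nat) (B : nat -> set U), uniq s ->
    (forall i, measurable (B i)) ->
    P (\bigcap_(i in [set` s]) (X i @^-1` B i)) =
    \big[*%E/1]_(i <- s) P (X i @^-1` B i).

Definition has_density (mu : set U -> \bar R) (X : {RV P >-> U})
    (f : U -> R) : Prop :=
  forall A, measurable A -> distribution P X A = \int[mu]_(x in A) (f x)%:E.

End sampling.

(* Main.v *)
Require Import Defs.
From mathcomp Require Import all_boot all_order all_algebra.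
From mathcomp Require Import all_classical all_reals all_analysis.
From mathcomp Require Import measurable_realfun ring lra.

(** The second component may exploit very short initial sojourns. Fix a state
    [j0] with [alpha0 j0 > 0] and [beta0 j0 > 0], and consider the chain that
    starts in [j0], leaves it at rate [b] and never moves again. Its density
    divided by the null density is a function [r_b] of the path that is bounded
    for each [b] and has mean 1 under the null, while its second moment grows
    at least linearly in [b] ([fast_exit_second_moment]). A bounded [r_b] has bounded
    covariance with every [r_b'], so that for widely separated rates the
    standardised scores [v_k = (r_k - 1) / sd(r_k)] are nearly uncorrelated, and
    any number [K] of them can be found ([decorrelated_scores]).

    No limit theorem is needed to see that one of these [K] directions makes the
    likelihood ratio large. Give the second component the weight that turns the
    ratio of one observation into [1 + y * v_k] with [y ^+ 2 * n = s]. The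
    likelihood ratios [L_k = \prod_i (1 + y * v_k (X_i))] have mean 1 and
    [E (L_k L_l) <= exp (s * cov(v_k, v_l))], hence their average [W] has variance
    about [exp s / K], and is close to 1 when [K] is large. If, on the other
    hand, every [L_k] were at most [exp M], then [W] would be at most
    [exp (M / 2)] times the average of the [sqrt L_k], whose mean is at most
    [exp (- s / 16)] because [1 + y * v_k] fluctuates. Both are compatible only
    on an event of small probability, once [s] and then [K] are large
    ([second_moment_bound], [mixture_divergence]). This uses only that the
    expectation of a product over independent observations is a product
    ([expectation_prod]).

    The event that the statistic is at most [M] says that the mixture likelihood
    is at most [exp M] times the null likelihood for all parameters
    ([loglik_ratio_leP]). It is measurable since, the likelihood being continuous
    in the parameters, countably many of them suffice ([mixture_lik_le_grid]). *)

Set Implicit Arguments.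
Unset Strict Implicit.
Unset Printing Implicit Defensive.

Import Order.TTheory GRing.Theory Num.Theory.
Import numFieldNormedType.Exports.

Local Open Scope classical_set_scope.
Local Open Scope ring_scope.

(** * Integration against a density *)

Section integral_against_density.
Local Open Scope ereal_scope.
Context d1 d2 (T1 : measurableType d1) (T2 : measurableType d2) (R : realType).
Variables (mu : {measure set T1 -> \bar R}) (nu : {measure set T2 -> \bar R}).
Variables (h : T1 -> T2) (F : T1 -> R).
Hypotheses (mh : measurable_fun setT h) (mF : measurable_fun setT F).
Hypothesis F0 : forall x, (0 <= F x)%R.
Hypothesis nuE : forall B, measurable B -> nu B = \int[mu]_(x in h @^-1` B) (F x)%:E.

Import HBNNSimple.

Let integral_against_density_nnsfun (g : {nnsfun T2 >-> R}) :
  \int[nu]_y (g y)%:E = \int[mu]_x ((g (h x))%:E * (F x)%:E).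
Proof.
have mi r : measurable_fun setT
    (fun x => (\1_(g @^-1` [set r]) (h x))%:E * (F x)%:E :> \bar R).
  apply: emeasurable_funM => //; apply/measurable_EFinP => //.
  exact: measurableT_comp mh.
transitivity (\int[nu]_y
    (\sum_(r \in range g) (r * \1_(g @^-1` [set r]) y)%:E)).
  by apply: eq_integral => y _; rewrite [in LHS]fimfunE -fsumEFin.
rewrite ge0_integral_fsum//; last 2 first.
  - by move=> r /=; apply: measurableT_comp => //; exact: measurableT_comp.
  - by move=> r t _; rewrite EFinM nnfun_muleindic_ge0.
transitivity (\sum_(r \in range g)
    \int[mu]_x (r%:E * (\1_(g @^-1` [set r]) (h x))%:E * (F x)%:E)); last first.
  rewrite -ge0_integral_fsum//; last 2 first.
  - by move=> r; under eq_fun do rewrite -muleA; exact: measurable_funeM.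
  - move=> r x _; rewrite mule_ge0 ?lee_fin//.
    exact: (nnfun_muleindic_ge0 g r (h x)).
  apply: eq_integral => x _; rewrite [in RHS]fimfunE -fsumEFin//.
  rewrite !fsbig_finite//= ge0_sume_distrl// => r _.
  by rewrite EFinM nnfun_muleindic_ge0.
apply: eq_fsbigr => r _.
have mgr : measurable (g @^-1` [set r]) by [].
under eq_integral do rewrite EFinM.
have [r0|r0] := leP 0%R r; last first.
  rewrite !integral0_eq// => x _; rewrite preimage_nnfun0// indicE in_set0.
    by rewrite mule0 mul0e.
  by rewrite mule0.
under [RHS]eq_integral do rewrite -muleA.
rewrite ge0_integralZl//; last first.
  by apply/measurable_EFinP; exact: measurable_indic.
rewrite ge0_integralZl//; last by move=> x _; rewrite mule_ge0// lee_fin.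
congr (_ * _); rewrite integral_indic// setIT nuE// integral_mkcond.
apply: eq_integral => x _; rewrite patchE indicE.
by rewrite (_ : (x \in _) = (h x \in g @^-1` [set r])) ?inE//; case: ifPn;
  rewrite ?mul1e ?mul0e.
Qed.

(** For indicators this is the hypothesis; it extends to simple functions by
    linearity and to all nonnegative functions by monotone convergence. *)
Lemma ge0_integral_against_density (g : T2 -> \bar R) :
  measurable_fun setT g -> (forall y, 0 <= g y) ->
  \int[nu]_y g y = \int[mu]_x (g (h x) * (F x)%:E).
Proof.
move=> mg g0; pose g_ := nnsfun_approx measurableT mg.
transitivity (limn (fun n => \int[nu]_y (g_ n y)%:E)).
  rewrite -monotone_convergence//.
  - by apply: eq_integral => y _; apply/esym/cvg_lim => //; exact: cvg_nnsfun_approx.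
  - by move=> n; exact/measurable_EFinP.
  - by move=> n y _; rewrite lee_fin.
  - by move=> y _ m n mn; rewrite lee_fin; exact/lefP/nd_nnsfun_approx.
under eq_fun do rewrite integral_against_density_nnsfun.
rewrite -monotone_convergence//.
- apply: eq_integral => x _; apply/cvg_lim => //.
  by apply: cvgeZr; [|exact: cvg_nnsfun_approx].
- move=> n; apply: emeasurable_funM; apply/measurable_EFinP => //.
  exact: measurableT_comp mh.
- by move=> n x _; rewrite mule_ge0// lee_fin.
- move=> x _ m n mn; rewrite lee_wpmul2r ?lee_fin ?F0//.
  exact/lefP/nd_nnsfun_approx.
Qed.

End integral_against_density.

(** * Expectations of products over independent observations *)

Section expectation_of_product.
Context d d' (Omega : measurableType d) (U : measurableType d') (R : realType).
Variables (P : probability Omega R) (X : nat -> {RV P >-> U}).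
Hypothesis X_indep : independent_seq X.
Hypothesis X_id : forall i A, measurable A ->
  distribution P (X i) A = distribution P (X 0) A.
Local Notation nu := (distribution P (X 0)).

Let law (A : set U) : R := fine (nu A).

Let lawE A : measurable A -> nu A = (law A)%:E.
Proof. by move=> mA; rewrite fineK// fin_num_measure. Qed.

Let expectation_prod_indic (s : seq nat) (B : nat -> set U) :
  uniq s -> (forall i, measurable (B i)) ->
  (\int[P]_omega (\prod_(i <- s) \1_(B i) (X i omega))%:E)%E =
  (\prod_(i <- s) law (B i))%:E.
Proof.
move=> us mB; rewrite -prodEFin.
have -> : (\prod_(i <- s) (law (B i))%:E = \prod_(i <- s) P (X i @^-1` B i))%E.
  by apply: eq_bigr => i _; rewrite -lawE// -(X_id i).
rewrite -X_indep// -[in RHS](setIT (\bigcap_(i in _) _)) -integral_indic//.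
  apply: eq_integral => omega _; congr EFin.
  rewrite indicE; have [|/negP sN] := boolP (omega \in _).
    rewrite inE => sB; apply: big1_seq => i /= /sB.
    by rewrite indicE /preimage/= => XB; rewrite mem_set.
  have [i [si XB]] : exists i, i \in s /\ ~ B i (X i omega).
    apply: contrapT => /forallNP H; apply: sN; rewrite inE => i /= si.
    by apply: contrapT => XB; apply: (H i).
  apply/eqP; rewrite prodf_seq_eq0; apply/hasP; exists i => //=.
  by rewrite indicE memNset.
apply: fin_bigcap_measurable => // i _.
by rewrite -(setTI (_ @^-1` _)); exact: measurable_funP.
Qed.

(** Independence is a statement about indicators. They are replaced one at a
    time by general functions: with the other factors held fixed, both sides
    are measures in the remaining argument, hence agree on all functions as
    soon as they agree on sets. *)
Let expectation_prod_fun_indic (n : nat) (g : nat -> U -> R) (a : nat -> R) :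
  (forall i, measurable_fun setT (g i)) -> (forall i x, 0 <= g i x) ->
  (forall i, (\int[nu]_x (g i x)%:E)%E = (a i)%:E) ->
  forall (s : seq nat) (B : nat -> set U), uniq s -> all (leq n) s ->
    (forall i, measurable (B i)) ->
  (\int[P]_omega (\prod_(i < n) g i (X i omega) *
                  \prod_(i <- s) \1_(B i) (X i omega))%:E)%E =
  (\prod_(i < n) a i * \prod_(i <- s) law (B i))%:E.
Proof.
move=> mg g0 ga; elim: n => [|n IHn] s B us ns mB.
  under eq_integral do rewrite big_ord0 mul1r.
  by rewrite big_ord0 mul1r expectation_prod_indic.
have a0 i : 0 <= a i.
  by rewrite -lee_fin -ga; apply: integral_ge0 => x _; rewrite lee_fin.
pose F omega := \prod_(i < n) g i (X i omega) *
  \prod_(i <- s) \1_(B i) (X i omega).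
have mF : measurable_fun setT F.
  apply: measurable_funM; apply: measurable_prod => i _.
    by apply: measurableT_comp.
  by apply: measurableT_comp => //; exact: measurable_indic.
have F0 omega : 0 <= F omega.
  by rewrite mulr_ge0//; apply: prodr_ge0 => i _; rewrite // indicE.
pose c := \prod_(i < n) a i * \prod_(i <- s) law (B i).
have c0 : 0 <= c.
  by rewrite mulr_ge0//; apply: prodr_ge0 => i _; rewrite // fine_ge0.
have nus : n \notin s by apply/negP => /(allP ns); rewrite ltnn.
have sn : all (leq n) s by apply/allP => i /(allP ns) /ltnW.
have nuE C : measurable C ->
    mscale (NngNum c0) nu C = (\int[P]_(omega in X n @^-1` C) (F omega)%:E)%E.
  move=> mC; rewrite /mscale/= lawE// -EFinM.
  pose B' i := if i == n then C else B i.
  have mB' i : measurable (B' i) by rewrite /B'; case: ifP.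
  have B'n : B' n = C by rewrite /B' eqxx.
  have B's (f : nat -> set U -> R) :
      \prod_(i <- s) f i (B' i) = \prod_(i <- s) f i (B i).
    apply: eq_big_seq => i si; rewrite /B' ifF//.
    by apply/negbTE; apply: contraNneq nus => <-.
  have := IHn (n :: s) B'; rewrite /= nus us leqnn sn => /(_ isT isT mB').
  rewrite big_cons (B's (fun=> law)) B'n mulrCA [law C * _]mulrC => <-.
  rewrite [RHS]integral_mkcond; apply: eq_integral => omega _.
  rewrite big_cons (B's (fun i C => \1_C (X i omega))) B'n patchE indicE.
  rewrite (_ : (omega \in _) = (X n omega \in C))//.
  by case: ifPn => _; rewrite /F; [rewrite mul1r|rewrite mul0r mulr0].
have Xn : measurable_fun setT (X n) by [].
have mgn : measurable_fun setT (EFin \o g n) by exact/measurable_EFinP.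
have gn0 x : (0 <= (EFin \o g n) x)%E by rewrite lee_fin.
have := ge0_integral_against_density Xn mF F0 nuE mgn gn0.
rewrite ge0_integral_mscale// ga -EFinM /c/= => H.
rewrite big_ord_recr/= mulrAC H.
apply: eq_integral => omega _; rewrite big_ord_recr/= -EFinM /F.
by congr EFin; ring.
Qed.

Lemma expectation_prod (n : nat) (g : U -> R) (a : R) :
  measurable_fun setT g -> (forall x, 0 <= g x) ->
  (\int[nu]_x (g x)%:E)%E = a%:E ->
  (\int[P]_omega (\prod_(i < n) g (X i omega))%:E)%E = (a ^+ n)%:E.
Proof.
move=> mg g0 ga.
have := @expectation_prod_fun_indic n (fun=> g) (fun=> a) (fun=> mg)
  (fun=> g0) (fun=> ga) [::] (fun=> setT) isT isT (fun=> measurableT).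
rewrite big_nil mulr1 prodr_const card_ord => <-.
by apply: eq_integral => omega _; rewrite big_nil mulr1.
Qed.

End expectation_of_product.

(** * Bounded functions and their means *)

Section bounded_measurable.
Context d (U : measurableType d) (R : realType).
Implicit Types f g : U -> R.

Definition bounded_measurable f :=
  measurable_fun setT f /\ exists C, forall u, `|f u| <= C.

Lemma bounded_measurable_cst (c : R) : bounded_measurable (fun=> c).
Proof. by split => //; exists `|c|. Qed.

Lemma bounded_measurableD f g : bounded_measurable f -> bounded_measurable g ->
  bounded_measurable (fun u => f u + g u).
Proof.
move=> [mf [C fC]] [mg [D gD]]; split; first exact: measurable_funD.
by exists (C + D) => u; rewrite (le_trans (ler_normD _ _))// lerD.
Qed.

Lemma bounded_measurableM f g : bounded_measurable f -> bounded_measurable g ->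
  bounded_measurable (fun u => f u * g u).
Proof.
move=> [mf [C fC]] [mg [D gD]]; split; first exact: measurable_funM.
by exists (C * D) => u; rewrite normrM ler_pM.
Qed.

Lemma bounded_measurable_sum (I : Type) (s : seq I) (f : I -> U -> R) :
  (forall i, bounded_measurable (f i)) ->
  bounded_measurable (fun u => \sum_(i <- s) f i u).
Proof.
move=> bf; elim: s => [|i s IH].
  by under eq_fun do rewrite big_nil; exact: bounded_measurable_cst.
by under eq_fun do rewrite big_cons; exact: bounded_measurableD.
Qed.

Lemma bounded_measurable_prod (I : Type) (s : seq I) (f : I -> U -> R) :
  (forall i, bounded_measurable (f i)) ->
  bounded_measurable (fun u => \prod_(i <- s) f i u).
Proof.
move=> bf; elim: s => [|i s IH].
  by under eq_fun do rewrite big_nil; exact: bounded_measurable_cst.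
by under eq_fun do rewrite big_cons; exact: bounded_measurableM.
Qed.

Lemma bounded_measurable_indic A : measurable A -> bounded_measurable \1_A.
Proof.
move=> mA; split; first exact: measurable_indic.
by exists 1 => u; rewrite indicE; case: (_ \in _); rewrite ?normr1 ?normr0.
Qed.

End bounded_measurable.

Section bounded_expectation.
Context d (U : measurableType d) (R : realType) (Q : probability U R).
Implicit Types f g : U -> R.

Definition mean f : R := (\int[Q]_u f u)%R.

Lemma bounded_measurable_integrable f : bounded_measurable f ->
  Q.-integrable setT (EFin \o f).
Proof.
move=> [mf [C fC]]; apply: measurable_bounded_integrable => //.
  by rewrite (le_lt_trans (probability_le1 Q _))// ltry.
by exists C; split; [exact: num_real|move=> D CD u _; exact: le_trans (ltW CD)].
Qed.

Lemma mean_EFin f : bounded_measurable f ->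
  (\int[Q]_u (f u)%:E)%E = (mean f)%:E.
Proof.
move=> bf; rewrite /mean /Rintegral fineK//.
exact: integrable_fin_num (bounded_measurable_integrable bf).
Qed.

Lemma mean_cst c : mean (fun=> c) = c.
Proof. rewrite /mean Rintegral_cst// -[RHS]mulr1; congr (_ * _).
by have /(congr1 fine) := @probability_setT _ _ _ Q. Qed.

Lemma eq_mean f g : f =1 g -> mean f = mean g.
Proof. by move=> fg; congr mean; exact/funext. Qed.

Lemma meanD f g : bounded_measurable f -> bounded_measurable g ->
  mean (fun u => f u + g u) = mean f + mean g.
Proof.
by move=> bf bg; rewrite /mean RintegralD//; exact: bounded_measurable_integrable.
Qed.

Lemma meanZ c f : bounded_measurable f -> mean (fun u => c * f u) = c * mean f.
Proof.
by move=> bf; rewrite /mean RintegralZl//; exact: bounded_measurable_integrable.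
Qed.

Lemma mean_sum (I : Type) (s : seq I) (f : I -> U -> R) :
  (forall i, bounded_measurable (f i)) ->
  mean (fun u => \sum_(i <- s) f i u) = \sum_(i <- s) mean (f i).
Proof.
move=> bf; elim: s => [|i s IH].
  by rewrite big_nil -[RHS]mean_cst; apply: eq_mean => u; rewrite big_nil.
rewrite big_cons -IH -meanD//; last exact: bounded_measurable_sum.
by apply: eq_mean => u; rewrite big_cons.
Qed.

Lemma le_mean f g : bounded_measurable f -> bounded_measurable g ->
  (forall u, f u <= g u) -> mean f <= mean g.
Proof.
by move=> bf bg fg; apply: le_Rintegral => //; exact: bounded_measurable_integrable.
Qed.

Lemma mean_ge0 f : (forall u, 0 <= f u) -> 0 <= mean f.
Proof. by move=> f0; apply: Rintegral_ge0. Qed.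

Lemma mean_indic A : measurable A -> (mean \1_A)%:E = Q A.
Proof.
move=> mA; rewrite -mean_EFin; last exact: bounded_measurable_indic.
by rewrite integral_indic// setIT.
Qed.

End bounded_expectation.

(** * The second-moment argument *)

Section second_moment_bound.
Context d d' (Omega : measurableType d) (U : measurableType d') (R : realType).
Variables (P : probability Omega R) (X : nat -> {RV P >-> U}).
Hypothesis X_indep : independent_seq X.
Hypothesis X_id : forall i A, measurable A ->
  distribution P (X i) A = distribution P (X 0) A.
Local Notation E := (@mean _ _ _ (distribution P (X 0))).

Let bounded_measurable_RV i (g : U -> R) : bounded_measurable g ->
  bounded_measurable (fun omega => g (X i omega)).
Proof.
move=> [mg [C gC]]; split; last by exists C.
exact: measurableT_comp mg _.
Qed.

Lemma mean_prod n (g : U -> R) : bounded_measurable g -> (forall u, 0 <= g u) ->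
  mean P (fun omega => \prod_(i < n) g (X i omega)) = E g ^+ n.
Proof.
move=> bg g0; apply: EFin_inj.
rewrite -mean_EFin; last first.
  by apply: bounded_measurable_prod => i; exact: bounded_measurable_RV.
by rewrite (expectation_prod X_indep X_id n bg.1 g0 (mean_EFin _ bg)).
Qed.

(** A quadratic upper bound for [Num.sqrt (1 + t)]; unlike the root, it has a mean
    that is determined by the first two moments of [t]. *)
Lemma le1D_sqr (t : R) : `|t| <= 1 ->
  0 <= 1 + t / 2 - t ^+ 2 / 16 /\ 1 + t <= (1 + t / 2 - t ^+ 2 / 16) ^+ 2.
Proof.
rewrite ler_norml => /andP[t1 t2]; split; first by nra.
rewrite -subr_ge0.
have -> : (1 + t / 2 - t ^+ 2 / 16) ^+ 2 - (1 + t) =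
  t ^+ 2 * ((2 - t) / 16 + t ^+ 2 / 256) by field.
by rewrite mulr_ge0 ?sqr_ge0// addr_ge0 ?divr_ge0 ?sqr_ge0// subr_ge0; lra.
Qed.

(** Let [W] be the average of the [K] products, which have mean 1. On [A] each
    product is at most [expR (M / 2)] times its square root; let [V] be the average
    of these bounds, with [le1D_sqr] applied to each factor. On [A] then
    [W <= V], so that [W] is at most 1/2 or [V] is at least 1/2, whence
    [\1_A <= 4 * (W - 1) ^+ 2 + 2 * V]. The two terms of the conclusion bound the
    variance of [W] and the mean of [V]. *)
Lemma second_moment_bound (K n : nat) (v : 'I_K -> U -> R) (y s del M : R)
    (A : set Omega) :
  (0 < K)%N -> y ^+ 2 * n%:R = s -> 0 <= s ->
  (forall k, bounded_measurable (v k)) -> (forall k u, `|y * v k u| <= 1) ->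
  (forall k, E (v k) = 0) -> (forall k, E (fun u => v k u ^+ 2) = 1) ->
  (forall k l, k != l -> E (fun u => v k u * v l u) <= del) ->
  measurable A ->
  (forall omega, A omega ->
     forall k, \prod_(i < n) (1 + y * v k (X i omega)) <= expR M) ->
  (P A <= (4 * (expR s / K%:R + expR (s * del) - 1) +
           2 * expR (M / 2) * expR (- (s / 16)))%:E)%E.
Proof.
move=> K0 yn s0 bv yv1 Ev Ev2 Evv mA AL.
pose L k omega := \prod_(i < n) (1 + y * v k (X i omega)).
pose h k u := 1 + (y * v k u) / 2 - (y * v k u) ^+ 2 / 16.
pose H k omega := \prod_(i < n) h k (X i omega).
pose kap : R := K%:R^-1.
have K0' : 0 < K%:R :> R by rewrite ltr0n.
have l0 k u : 0 <= 1 + y * v k u.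
  by have := yv1 k u; rewrite ler_norml => /andP[? _]; lra.
have L0 k omega : 0 <= L k omega by apply: prodr_ge0.
have H0 k omega : 0 <= H k omega.
  by apply: prodr_ge0 => i _; have [] := le1D_sqr (yv1 k (X i omega)).
have LH k omega : L k omega <= H k omega ^+ 2.
  rewrite /H -prodrXl; apply: ler_prod => i _; rewrite l0/=.
  by have [] := le1D_sqr (yv1 k (X i omega)).
have bl k : bounded_measurable (fun u => 1 + y * v k u).
  apply: bounded_measurableD; first exact: bounded_measurable_cst.
  by apply: bounded_measurableM => //; exact: bounded_measurable_cst.
have bh k : bounded_measurable (h k).
  have -> : h k = fun u => 1 + ((y / 2) * v k u + - (y ^+ 2 / 16) * (v k u * v k u)).
    by apply/funext => u; rewrite /h; field.
  do !(apply: bounded_measurableD || apply: bounded_measurableM ||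
    apply: bounded_measurable_cst || apply: bv).
have bL k : bounded_measurable (L k).
  by apply: bounded_measurable_prod => i; exact: (bounded_measurable_RV _ (bl k)).
have bH k : bounded_measurable (H k).
  by apply: bounded_measurable_prod => i; exact: bounded_measurable_RV.
have EL k : mean P (L k) = 1.
  rewrite /L (mean_prod n (bl k))// meanD; last 2 first.
  - exact: bounded_measurable_cst.
  - by apply: bounded_measurableM => //; exact: bounded_measurable_cst.
  by rewrite mean_cst meanZ// Ev mulr0 addr0 expr1n.
have bvv k l : bounded_measurable (fun u => v k u * v l u).
  exact: bounded_measurableM.
have ELL k l : mean P (fun omega => L k omega * L l omega) <=
    (k == l)%:R * expR s + expR (s * del).
  have -> : mean P (fun omega => L k omega * L l omega) =
      mean P (fun omega => \prod_(i < n)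
         ((1 + y * v k (X i omega)) * (1 + y * v l (X i omega)))).
    by apply: eq_mean => omega; rewrite /L big_split.
  rewrite (@mean_prod n (fun u => (1 + y * v k u) * (1 + y * v l u))); last 2 first.
  - exact: bounded_measurableM.
  - by move=> u; exact: mulr_ge0.
  set e := E _; pose c := E (fun u => v k u * v l u).
  have e0 : 0 <= e by apply: mean_ge0 => u; exact: mulr_ge0.
  have eE : e = 1 + y ^+ 2 * c.
    rewrite /e (_ : (fun u => _) = fun u => 1 +
      (y * v k u + (y * v l u + y ^+ 2 * (v k u * v l u)))); last first.
      by apply/funext => u; ring.
    rewrite !meanD ?mean_cst ?meanZ ?Ev ?mulr0 ?add0r//;
      do !(apply: bounded_measurableD || apply: bounded_measurableM ||
        apply: bounded_measurable_cst || apply: bv).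
  have en : e ^+ n <= expR (s * c).
    rewrite -yn mulrAC expRM_natr lerXn2r ?nnegrE ?expR_ge0//.
    by rewrite eE; exact: expR_ge1Dx.
  apply: (le_trans en); have [kl|kl] := eqVneq k l.
    rewrite mul1r /c kl (_ : E _ = 1); last by rewrite -(Ev2 l).
    by rewrite mulr1 lerDl expR_ge0.
  by rewrite mul0r add0r ler_expR ler_wpM2l// Evv.
have EH k : mean P (H k) <= expR (- (s / 16)).
  rewrite /H (mean_prod n (bh k)); last first.
    by move=> u; have [] := le1D_sqr (yv1 k u).
  have -> : E (h k) = 1 + - (y ^+ 2 / 16).
    have -> : h k = fun u => 1 + ((y / 2) * v k u + - (y ^+ 2 / 16) * (v k u ^+ 2)).
      by apply/funext => u; rewrite /h; field.
    rewrite !meanD ?mean_cst ?meanZ ?Ev ?Ev2 ?mulr0 ?add0r ?mulr1//;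
      do !(apply: bounded_measurableD || apply: bounded_measurableM ||
        apply: bounded_measurable_cst || apply: bv).
  have -> : - (s / 16) = - (y ^+ 2 / 16) * n%:R by rewrite -yn; field.
  rewrite expRM_natr.
  rewrite lerXn2r ?nnegrE ?expR_ge0 ?expR_ge1Dx//.
  suff : y ^+ 2 <= 1 by move=> ?; lra.
  have <- : E (fun u => (y * v k u) ^+ 2) = y ^+ 2.
    under eq_fun do rewrite exprMn.
    by rewrite meanZ ?Ev2 ?mulr1//; exact: bvv.
  rewrite -[leRHS](mean_cst (distribution P (X 0))).
  apply: le_mean; [|exact: bounded_measurable_cst|].
    by do !(apply: bounded_measurableM || apply: bounded_measurable_cst || apply: bv).
  by move=> u; rewrite -real_normK ?num_real// expr_le1.
rewrite -mean_indic//.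
(* [G] is [4 * (W - 1) ^+ 2 + 2 * V] with the square expanded. *)
pose S omega := \sum_k L k omega; pose V omega := \sum_k H k omega.
pose G omega := 4 * kap ^+ 2 * (\sum_k \sum_l L k omega * L l omega) +
  (- (8 * kap) * S omega + (4 + 2 * expR (M / 2) * kap * V omega)).
have AG omega : \1_A omega <= G omega.
  have -> : G omega = 4 * (kap * S omega - 1) ^+ 2 +
      2 * (expR (M / 2) * kap * V omega).
    rewrite /G (_ : \sum_k \sum_l _ = S omega ^+ 2); first by ring.
    by rewrite expr2 big_distrlr.
  have kap0 : 0 <= kap by rewrite invr_ge0.
  have V0 : 0 <= expR (M / 2) * kap * V omega.
    by rewrite !mulr_ge0 ?expR_ge0//; exact: sumr_ge0.
  rewrite indicE; have [Ao|_] := boolP (omega \in A); last first.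
    by rewrite addr_ge0// mulr_ge0// sqr_ge0.
  have SV : kap * S omega <= expR (M / 2) * kap * V omega.
    rewrite [_ * kap]mulrC -mulrA ler_wpM2l// mulr_sumr; apply: ler_sum => k _.
    rewrite -ler_sqr ?nnegrE ?mulr_ge0 ?expR_ge0// exprMn -expRM_natl.
    rewrite [2%:R * _]mulrC divfK// expr2.
    apply: ler_pM => //; exact: AL (set_mem Ao) k.
  move: (kap * S omega) (expR (M / 2) * kap * V omega) V0 SV => a b b0 ab.
  have sqr0 := sqr_ge0 (a - 1).
  have [a2|a2] := leP a (2^-1); rewrite /=; last by lra.
  have : 0 <= (1 - 2 * a) * (3 - 2 * a) by apply: mulr_ge0; lra.
  nra.
have bS : bounded_measurable S by exact: bounded_measurable_sum.
have bV : bounded_measurable V by exact: bounded_measurable_sum.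
have bLL k l : bounded_measurable (fun omega => L k omega * L l omega).
  exact: bounded_measurableM.
have bSS : bounded_measurable (fun omega => \sum_k \sum_l L k omega * L l omega).
  by apply: bounded_measurable_sum => k; exact: bounded_measurable_sum.
have bZ c f : bounded_measurable f ->
    bounded_measurable (fun omega : Omega => c * f omega).
  by apply: bounded_measurableM; exact: bounded_measurable_cst.
have bVV : bounded_measurable (fun omega => 4 + 2 * expR (M / 2) * kap * V omega).
  by apply: bounded_measurableD; [exact: bounded_measurable_cst|exact: bZ].
have bSV : bounded_measurable (fun omega => - (8 * kap) * S omega +
    (4 + 2 * expR (M / 2) * kap * V omega)).
  by apply: bounded_measurableD => //; exact: bZ.
have bG : bounded_measurable G by apply: bounded_measurableD => //; exact: bZ.
rewrite lee_fin (le_trans (le_mean P (bounded_measurable_indic _ mA) bG AG))//.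
rewrite /G meanD//; last exact: bZ.
rewrite meanZ// meanD//; last exact: bZ.
rewrite meanZ// meanD//; [|exact: bounded_measurable_cst|exact: bZ].
rewrite mean_cst meanZ//.
rewrite (mean_sum P _ bL) (mean_sum P _ bH) mean_sum; last first.
  by move=> k; exact: bounded_measurable_sum.
have -> : \sum_k mean P (L k) = K%:R.
  by under eq_bigr do rewrite EL; rewrite sumr_const card_ord.
have HV : \sum_k mean P (H k) <= K%:R * expR (- (s / 16)).
  rewrite mulr_natl -[X in _ *+ X]card_ord -sumr_const.
  exact: ler_sum.
have HS : \sum_k mean P (fun omega => \sum_l L k omega * L l omega) <=
    K%:R * expR s + K%:R ^+ 2 * expR (s * del).
  have -> : K%:R * expR s + K%:R ^+ 2 * expR (s * del) =
      \sum_(k < K) \sum_(l < K) ((k == l)%:R * expR s + expR (s * del)).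
    under eq_bigr => k _.
      rewrite big_split/= sumr_const card_ord -mulr_suml.
      rewrite (bigD1 k)//= eqxx big1 ?addr0 ?mul1r; last first.
        by move=> l /negbTE; rewrite eq_sym => ->.
      over.
    rewrite sumr_const card_ord -[RHS]mulr_natl -[_ (s * del) *+ K]mulr_natl.
    by ring.
  by apply: ler_sum => k _; rewrite mean_sum//; exact: ler_sum.
have kK : kap * K%:R = 1 by rewrite mulVf// gt_eqF.
have kap0 : 0 <= kap by rewrite invr_ge0 ltW.
have H1 : kap ^+ 2 * (\sum_k mean P (fun omega => \sum_l L k omega * L l omega)) <=
   kap * expR s + expR (s * del).
  apply: (le_trans (ler_wpM2l (sqr_ge0 _) HS)).
  have -> : kap ^+ 2 * (K%:R * expR s + K%:R ^+ 2 * expR (s * del)) =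
    kap * (kap * K%:R) * expR s + (kap * K%:R) ^+ 2 * expR (s * del) by ring.
  by rewrite kK mulr1 expr1n mul1r.
have H2 : kap * (\sum_k mean P (H k)) <= expR (- (s / 16)).
  by apply: (le_trans (ler_wpM2l kap0 HV)); rewrite mulrA kK mul1r.
have H3 := ler_wpM2l (expR_ge0 (M / 2)) H2.
rewrite -/kap [expR s * _]mulrC; move: kK H1 H3.
move: (\sum_k mean P (H k)) (\sum_k mean P (fun omega => \sum_l _)) => b a kK H1 H3.
have -> : 4 * kap ^+ 2 * a + (- (8 * kap) * K%:R + (4 + 2 * expR (M / 2) * kap * b)) =
  4 * (kap ^+ 2 * a) - 8 * (kap * K%:R) + 4 + 2 * (expR (M / 2) * (kap * b)) by ring.
rewrite kK; lra.
Qed.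

End second_moment_bound.

(** * Mixtures with a family of unbounded second moment *)

Section decorrelated_scores.
Context d (U : measurableType d) (R : realType) (Q : probability U R).
Variable r : nat -> U -> R.
Hypotheses (br : forall k, bounded_measurable (r k)) (r0 : forall k u, 0 <= r k u).
Hypothesis r1 : forall k, mean Q (r k) = 1.
Hypothesis r2 : mean Q (fun u => r k u ^+ 2) @[k --> \oo] --> +oo.

Definition score_sd k := Num.sqrt (mean Q (fun u => r k u ^+ 2) - 1).

Definition score k u := (score_sd k)^-1 * (r k u - 1).

Lemma bounded_measurable_score k : bounded_measurable (score k).
Proof.
apply: bounded_measurableM; first exact: bounded_measurable_cst.
by apply: bounded_measurableD => //; exact: bounded_measurable_cst.
Qed.

Lemma mean_score k : mean Q (score k) = 0.
Proof.
rewrite meanZ; last by apply: bounded_measurableD => //; exact: bounded_measurable_cst.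
rewrite meanD//; last exact: bounded_measurable_cst.
by rewrite mean_cst r1 subrr mulr0.
Qed.

Lemma mean_scoreM k l : mean Q (fun u => score k u * score l u) =
  (score_sd k)^-1 * (score_sd l)^-1 * (mean Q (fun u => r k u * r l u) - 1).
Proof.
have brr : bounded_measurable (fun u => r k u * r l u) by exact: bounded_measurableM.
have bN c j : bounded_measurable (fun u => c * r j u).
  by apply: bounded_measurableM => //; exact: bounded_measurable_cst.
have b1 : bounded_measurable (fun u => -1 * r l u + 1).
  by apply: bounded_measurableD => //; exact: bounded_measurable_cst.
have bkl : bounded_measurable (fun u => -1 * r k u + (-1 * r l u + 1)).
  exact: bounded_measurableD.
have -> : (fun u => score k u * score l u) = (fun u =>
    ((score_sd k)^-1 * (score_sd l)^-1) *
    (r k u * r l u + (-1 * r k u + (-1 * r l u + 1)))).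
  by apply/funext => u; rewrite /score; ring.
rewrite meanZ; last exact: bounded_measurableD.
rewrite !meanD//; last exact: bounded_measurable_cst.
by rewrite !meanZ// mean_cst !r1; congr (_ * _); ring.
Qed.

Lemma mean_score_sqr k : 1 <= score_sd k -> mean Q (fun u => score k u ^+ 2) = 1.
Proof.
move=> sd1; have sd0 : 0 < score_sd k by rewrite (lt_le_trans _ sd1).
under eq_fun do rewrite expr2.
rewrite mean_scoreM -invfM -expr2 sqr_sqrtr; last by rewrite ltW// -sqrtr_gt0.
rewrite mulVf//; apply/negP => /eqP sd.
by move: sd0; rewrite /score_sd sd sqrtr0 ltxx.
Qed.

(** A bounded [r k] has covariance with [r l] at most its bound, whatever [l],
    while the standard deviation of [r l] grows without limit. *)
Lemma decorrelated_scores (del : R) (K : nat) : 0 < del ->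
  exists s : seq nat, [/\ size s = K, all (fun k => 1 <= score_sd k) s &
    pairwise (fun k l => mean Q (fun u => score k u * score l u) <= del) s].
Proof.
move=> del0; elim: K => [|K [s [sK sd1 ss]]]; first by exists [::].
have /choice[C rC] k : exists C, forall u, r k u <= C.
  by have [_ [C rC]] := br k; exists C => u; rewrite (le_trans (ler_norm _)).
pose B := \sum_(k <- s) `|C k| / del.
have B0 : 0 <= B by apply: sumr_ge0 => k _; rewrite divr_ge0// ltW.
have CB k : k \in s -> `|C k| / del <= B.
  move=> ks; rewrite /B (big_rem k)//= lerDl; apply: sumr_ge0 => j _.
  by rewrite divr_ge0// ltW.
have [l l2] : exists l, (1 + B) ^+ 2 + 1 <= mean Q (fun u => r l u ^+ 2).
  have /cvgryPge/(_ ((1 + B) ^+ 2 + 1)) [l _ H] := r2.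
  by exists l; exact: (H l (leqnn l)).
have lB : 1 + B <= score_sd l.
  rewrite -[leLHS]ger0_norm; last by rewrite addr_ge0.
  by rewrite -sqrtr_sqr ler_wsqrtr// lerBrDr.
have l1 : 1 <= score_sd l by rewrite (le_trans _ lB)// lerDl.
exists (l :: s); rewrite /= sK l1 ss andbT; split=> //.
apply/allP => k ks; rewrite mean_scoreM.
have l0 : 0 < score_sd l by rewrite (lt_le_trans _ l1).
have k1 := allP sd1 _ ks; have k0 : 0 < score_sd k by rewrite (lt_le_trans _ k1).
have H : mean Q (fun u => r l u * r k u) - 1 <= `|C k|.
  rewrite lerBlDr ler_wpDr// -[leRHS]mulr1 -(r1 l) -meanZ//.
  apply: le_mean => [||u]; first exact: bounded_measurableM.
    by apply: bounded_measurableM => //; exact: bounded_measurable_cst.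
  by rewrite mulrC ler_wpM2r// (le_trans (rC k u))// ler_norm.
rewrite -mulrA ler_pdivrMl// ler_pdivrMl//; apply: (le_trans H).
have lC : `|C k| <= score_sd l * del.
  by rewrite -ler_pdivrMr// (le_trans (CB k ks))// (le_trans _ lB)// lerDr.
by rewrite (le_trans lC)// ler_peMl// ltW// mulr_gt0.
Qed.

End decorrelated_scores.

Section mixture_divergence.
Context d d' (Omega : measurableType d) (U : measurableType d') (R : realType).
Variables (P : probability Omega R) (X : nat -> {RV P >-> U}).
Hypothesis X_indep : independent_seq X.
Hypothesis X_id : forall i A, measurable A ->
  distribution P (X i) A = distribution P (X 0) A.
Local Notation E := (@mean _ _ _ (distribution P (X 0))).

(** For a tolerance [eps], the strength [s] is chosen so that the mean of [V] is
    small, then the number [K] of directions and their admissible correlation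
    [del] so that the variance of [W] is small. The weight [y / sd(r_k)] with
    [y = Num.sqrt (s / n)] lies in [0, 1] and keeps [y * v k] in [-1, 1] for [n]
    large. *)
Lemma mixture_divergence (r : nat -> U -> R) (M : R) (A : nat -> set Omega) :
  (forall k, bounded_measurable (r k)) -> (forall k u, 0 <= r k u) ->
  (forall k, E (r k) = 1) -> E (fun u => r k u ^+ 2) @[k --> \oo] --> +oo ->
  (forall n, measurable (A n)) ->
  (forall n omega, A n omega -> forall k p, 0 <= p <= 1 ->
     \prod_(i < n) (1 - p + p * r k (X i omega)) <= expR M) ->
  P (A n) @[n --> \oo] --> 0%E.
Proof.
move=> br r0 r1 r2 mA AL.
suff H (eps : R) : 0 < eps -> \forall n \near \oo, (P (A n) <= eps%:E)%E.
  have -> : (fun n => P (A n)) = EFin \o (fun n => mean P \1_(A n)).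
    by apply/funext => n /=; rewrite mean_indic.
  apply: cvg_EFin; first exact: nearW.
  apply/cvgr0Pnorm_le => eps /H; apply: filterS => n; rewrite -mean_indic// lee_fin.
  by rewrite ger0_norm//; apply: mean_ge0 => omega; rewrite indicE.
move=> eps0; pose s : R := 16 * (`|M| + 8 / eps).
have s0 : 0 < s by rewrite mulr_gt0// ltr_wpDl// divr_gt0.
pose K := (Num.truncn (16 * expR s / eps)).+1.
pose del : R := ln (1 + eps / 16) / s.
have e16 : 1 < 1 + eps / 16 by rewrite ltrDl divr_gt0.
have del0 : 0 < del by rewrite divr_gt0// ln_gt0.
have [S [SK S1 Sdel]] := decorrelated_scores br r0 r1 r2 K del0.
have sS (k : 'I_K) : 1 <= score_sd (distribution P (X 0)) r (nth 0 S k).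
  by apply: (allP S1); rewrite mem_nth// SK.
pose v (k : 'I_K) := score (distribution P (X 0)) r (nth 0 S k).
have bv (k : 'I_K) : bounded_measurable (v k) by exact: bounded_measurable_score.
have [D vD] : exists D, forall k u, `|v k u| <= D.
  have /choice[D vD] (k : 'I_K) : exists D, forall u, `|v k u| <= D by case: (bv k).
  exists (\sum_k `|D k|) => k u; rewrite (le_trans (vD k u))//.
  by rewrite (le_trans (ler_norm _))// (bigD1 k)//= lerDl sumr_ge0.
near=> n.
have n1 : s * (D ^+ 2 + 1) <= n%:R by near: n; exact: nbhs_infty_ger.
have n0 : 0 < n%:R :> R.
  by rewrite (lt_le_trans _ n1)// mulr_gt0// ltr_wpDl// sqr_ge0.
pose y := Num.sqrt (s / n%:R).
have yn : y ^+ 2 * n%:R = s by rewrite sqr_sqrtr ?divfK ?gt_eqF// divr_ge0// ltW.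
have y0 : 0 <= y by exact: sqrtr_ge0.
have y2 : y ^+ 2 * (D ^+ 2 + 1) <= 1.
  rewrite sqr_sqrtr; last by rewrite divr_ge0// ltW.
  by rewrite mulrAC ler_pdivrMr// mul1r.
have yD : `|y * D| <= 1.
  by rewrite -(@expr_le1 _ 2)// real_normK ?num_real// exprMn; nra.
have y1 : y <= 1 by rewrite -(@expr_le1 _ 2)//; nra.
have yv1 (k : 'I_K) u : `|y * v k u| <= 1.
  rewrite (le_trans _ yD)// [leLHS]normrM [leRHS]normrM ler_wpM2l//.
  exact: le_trans (vD k u) (ler_norm _).
apply: le_trans (second_moment_bound (M := M) X_indep X_id (isT : (0 < K)%N) yn (ltW s0)
  bv yv1 _ _ _ (mA n) _) _.
- by move=> k; exact: mean_score.
- by move=> k; exact: mean_score_sqr.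
- move=> k l kl; have /(pairwiseP 0) SP := Sdel.
  wlog lt_kl : k l kl / (k < l)%N => [W|].
    have [lkl|llk|/val_inj/eqP] := ltngtP k l; last by rewrite (negbTE kl).
      exact: W.
    by under eq_fun do rewrite mulrC; apply: W => //; rewrite eq_sym.
  by apply: SP => //; rewrite inE SK.
- move=> omega /AL AnL k.
  pose p := y / score_sd (distribution P (X 0)) r (nth 0 S k).
  have sd0 : 0 < score_sd (distribution P (X 0)) r (nth 0 S k).
    exact: lt_le_trans (sS k).
  have p01 : 0 <= p <= 1.
    rewrite divr_ge0 ?(ltW sd0)//= ler_pdivrMr// mul1r.
    exact: le_trans (sS k).
  have := AnL (nth 0 S k) p p01.
  rewrite (eq_bigr (fun i : 'I_n => 1 + y * v k (X i omega)))// => i _.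
  by rewrite /v /score /p; ring.
rewrite lee_fin.
have -> : s * del = ln (1 + eps / 16) by rewrite /del mulrC divfK// gt_eqF.
rewrite lnK ?posrE ?(lt_trans ltr01)//.
have Kbig : expR s / K%:R <= eps / 16.
  rewrite ler_pdivrMr//.
  have := truncnS_gt (16 * expR s / eps).
  by rewrite -/K ltr_pdivrMr// => H; lra.
have ebig : expR (M / 2) * expR (- (s / 16)) <= eps / 8.
  rewrite -expRD -[leRHS]invrK invf_div -[leRHS]mul1r ler_pdivlMr ?divr_gt0//.
  rewrite (@le_trans _ _ (expR (- (8 / eps)) * expR (8 / eps)))//; last first.
    by rewrite -expRD addNr expR0.
  apply: ler_pM => //; rewrite ?expR_ge0 ?divr_ge0 ?(ltW eps0)//.
    have -> : s / 16 = `|M| + 8 / eps by rewrite /s [16 * _]mulrC mulfK.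
    by rewrite ler_expR; have := ler_norm M; have := normr_ge0 M; lra.
  by rewrite (le_trans _ (expR_ge1Dx _))// lerDr.
by rewrite -mulrA; lra.
Unshelve. all: by end_near. Qed.

End mixture_divergence.

(** * The density of a path *)

Lemma measurable_fun_sample_path (w : nat) (R : realType) d (V : measurableType d)
    (f : sample_path w R -> V) :
  (forall m (z : m.-tuple 'I_w),
     measurable_fun setT (fun t : m.-tuple (measurableTypeR R) => f (zip z t))) ->
  measurable_fun setT f.
Proof.
move=> mf _ B mB; rewrite setTI; suff : path_measurable (f @^-1` B) by [].
by move=> m z; rewrite -[X in measurable X]setTI; exact: mf.
Qed.

Lemma measurable_zip (w : nat) (R : realType) m (z : m.-tuple 'I_w) :
  measurable_fun setT
    (fun t : m.-tuple (measurableTypeR R) => zip z t : sample_path w R).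
Proof. by move=> _ A mA; rewrite setTI; exact: mA. Qed.

Section density_formula.
Context {w : nat} {R : realType}.
Variables (T : R) (gamma : 'M[R]_w).
Implicit Types (x : sample_path w R) (alpha beta : 'I_w -> R).

Definition initial_weight alpha x := oapp alpha 0 (ohead (unzip1 x)).

Definition jump_weight beta x := \prod_j \prod_(k | 0 < gamma j k)
  (beta j ^+ transitions x j k * gamma j k ^+ transitions x j k).

(** One formula covers all lengths: a path with a single sojourn spends the time
    [T] in its only state. *)
Lemma path_densityE alpha beta x :
  path_density T gamma (alpha, beta) x =
  (is_path T gamma x)%:R * (initial_weight alpha x *
    (expR (- \sum_j beta j * sojourn x j) * jump_weight beta x)).
Proof.
rewrite /path_density; have [xP|_] := ifPn; last by rewrite mul0r.
rewrite mul1r -sumrN expR_sum -big_split/=.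
case: x xP => [|e [|e' x]] xP; rewrite /initial_weight ?mul0r//=.
congr (_ * _); rewrite (bigD1 e.1)//= [X in _ = _ * X]big1.
  rewrite mulr1 [X in _ = _ * X]big1; last by move=> k _; rewrite !expr0 mulr1.
  move: xP => /and3P[_ /eqP + _]; rewrite big_seq1 => eT.
  by rewrite mulr1 /sojourn big_cons eqxx big_nil addr0 eT.
move=> j je; rewrite /sojourn big_cons big_nil eq_sym (negbTE je) mulr0 oppr0 expR0.
by rewrite mul1r big1// => k _; rewrite !expr0 mulr1.
Qed.

Lemma path_density_ge0 alpha beta x :
  (forall j, 0 <= alpha j) -> (forall j, 0 <= beta j) ->
  0 <= path_density T gamma (alpha, beta) x.
Proof.
move=> a0 b0; rewrite path_densityE !mulr_ge0 ?expR_ge0//.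
  by rewrite /initial_weight; case: (ohead _) => /=.
apply: prodr_ge0 => j _; apply: prodr_ge0 => k jk.
by rewrite mulr_ge0// exprn_ge0// ltW.
Qed.

Lemma path_density1 alpha beta j : 0 < T ->
  path_density T gamma (alpha, beta) [:: (j, T)] = alpha j * expR (- (beta j * T)).
Proof. by move=> T0; rewrite /path_density /is_path /= T0 big_seq1 eqxx. Qed.

Lemma path_density2 alpha beta j k s u : (forall i, gamma i i = 0) ->
  path_density T gamma (alpha, beta) [:: (j, s); (k, u)] =
  (is_path T gamma [:: (j, s); (k, u)])%:R *
  (alpha j * (beta j * gamma j k * expR (- (beta j * s + beta k * u)))).
Proof.
move=> g0; rewrite path_densityE.
have [xP|_] := boolP (is_path _ _ _); last by rewrite !mul0r.
have jk : 0 < gamma j k by case/and3P: xP => _ _ /=; rewrite andbT.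
have sum_sojourn : \sum_i beta i * sojourn [:: (j, s); (k, u)] i =
    beta j * s + beta k * u.
  transitivity (\sum_i ((i == j)%:R * (beta i * s) + (i == k)%:R * (beta i * u))).
    apply: eq_bigr => i _; rewrite /sojourn !big_cons big_nil/=.
    by rewrite [j == i]eq_sym [k == i]eq_sym; case: (i == j); case: (i == k);
      rewrite /= ?mul1r ?mul0r ?addr0 ?add0r ?mulr0 ?mulrDr.
  rewrite big_split/= (bigD1 j)//= eqxx mul1r big1; last first.
    by move=> i /negbTE ->; rewrite mul0r.
  rewrite addr0 (bigD1 k)//= eqxx mul1r big1 ?addr0//.
  by move=> i /negbTE ->; rewrite mul0r.
rewrite sum_sojourn /initial_weight/=; congr (_ * (_ * _)).
rewrite mulrC; congr (_ * _).
rewrite /jump_weight (bigD1 j)//= [X in _ * X]big1 ?mulr1; last first.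
  move=> i ij; rewrite big1// => l _.
  by rewrite /transitions/= eq_sym (negbTE ij)/= !expr0 mulr1.
rewrite (bigD1 k)//= big1 ?mulr1; last first.
  move=> l /andP[_ lk].
  by rewrite /transitions/= eqxx eq_sym (negbTE lk)/= !expr0 mulr1.
by rewrite /transitions/= !eqxx.
Qed.

(** The transition counts depend on the visited states only, hence are constant
    where measurability is tested. *)
Lemma transitions_unzip1 x j k :
  transitions x j k =
  count (fun e => (e.1 == j) && (e.2 == k)) (zip (unzip1 x) (behead (unzip1 x))).
Proof.
rewrite /transitions; case: x => // e x /=.
by elim: x e => // e' x IH e /=; rewrite -IH.
Qed.

Lemma big_zip m (z : m.-tuple 'I_w) (t : m.-tuple R) (Q : pred ('I_w * R))
    (F : 'I_w * R -> R) :
  \sum_(e <- zip z t | Q e) F e =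
  \sum_(i < m | Q (tnth z i, tnth t i)) F (tnth z i, tnth t i).
Proof.
have zi i : tnth (zip_tuple z t) i = (tnth z i, tnth t i).
  rewrite (tnth_nth (tnth z i, tnth t i)) /= nth_zip ?size_tuple//.
  by rewrite -!tnth_nth.
by rewrite (big_tuple _ _ (zip_tuple z t)); apply: eq_big => i; rewrite zi.
Qed.

Lemma is_pathE m (z : m.-tuple 'I_w) (t : m.-tuple R) :
  is_path T gamma (zip z t) =
  [&& [forall i, 0 < tnth t i], \sum_i tnth t i == T &
      sorted (fun j k => 0 < gamma j k) z].
Proof.
have st : unzip1 (zip z t) = z by rewrite unzip1_zip// !size_tuple.
have st2 : unzip2 (zip z t) = t by rewrite unzip2_zip// !size_tuple.
rewrite /is_path -[map fst _]/(unzip1 _) st big_zip/=; congr andb.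
rewrite -[all _ _]/(all (preim snd (fun s => 0 < s)) (zip z t)) -all_map.
rewrite -[map snd _]/(unzip2 _) st2; exact/all_tnthP/forallP.
Qed.

Lemma measurable_path_density alpha beta :
  measurable_fun setT (path_density T gamma (alpha, beta)).
Proof.
apply: measurable_fun_sample_path => m z.
have st (t : m.-tuple (measurableTypeR R)) : unzip1 (zip z t) = z.
  by rewrite unzip1_zip// !size_tuple.
apply: (eq_measurable_fun (fun t : m.-tuple (measurableTypeR R) =>
  (\prod_(i < m) \1_(`]0, +oo[ : set R) (tnth t i) *
   \1_[set T] (\sum_(i < m) tnth t i) *
   (sorted (fun j k => 0 < gamma j k) z)%:R) *
  (oapp alpha 0 (ohead z) *
   (expR (- \sum_j beta j * \sum_(i < m) (tnth z i == j)%:R * tnth t i) *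
   \prod_j \prod_(k | 0 < gamma j k)
     (beta j ^+ count (fun e => (e.1 == j) && (e.2 == k)) (zip z (behead z)) *
     gamma j k ^+ count (fun e => (e.1 == j) && (e.2 == k)) (zip z (behead z))))))).
  move=> t _; rewrite path_densityE; congr (_ * (_ * (_ * _))).
  - rewrite is_pathE; case: (sorted _ _); rewrite ?andbF ?mulr0// andbT mulr1.
    have -> : \1_[set T] (\sum_(i < m) tnth t i) = (\sum_i tnth t i == T)%:R :> R.
      by rewrite indicE; congr ((nat_of_bool _)%:R); apply/idP/eqP; rewrite inE.
    rewrite (eq_bigr (fun i : 'I_m => ((0 < tnth (t : m.-tuple R) i)%R)%:R)); last first.
      by move=> i _; rewrite indicE; congr ((nat_of_bool _)%:R); apply/idP/idP;
        rewrite inE/= in_itv/= andbT.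
    case: eqP => _; rewrite ?andbF ?mulr0// mulr1 andbT.
    case: forallP => [t0|t0]; first by rewrite big1// => i _; rewrite t0.
    have [i ti] : exists i, ~~ (0 < tnth (t : m.-tuple R) i).
      by apply/existsP; rewrite -negb_forall; apply/forallP.
    by rewrite (bigD1 i)//= (negbTE ti) mul0r.
  - by rewrite /initial_weight st.
  - congr (expR (- _)); apply: eq_bigr => j _; congr (_ * _).
    by rewrite /sojourn big_zip/= [in RHS]big_mkcond; apply: eq_bigr => i _; case: eqP;
      rewrite ?mul1r ?mul0r.
  - rewrite /jump_weight; apply: eq_bigr => j _; apply: eq_bigr => k _.
    by rewrite transitions_unzip1 st.
have mt i : measurable_fun setT (fun t : m.-tuple (measurableTypeR R) => tnth t i : R).
  exact: measurable_tnth.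
apply: measurable_funM.
  apply: measurable_funM => //; apply: measurable_funM.
    apply: measurable_prod => i _.
    by apply: measurableT_comp (mt i) => //; exact: measurable_indic.
  apply: measurableT_comp; first exact: measurable_indic.
  exact: measurable_sum.
apply: measurable_funM => //; apply: measurable_funM => //.
apply: measurableT_comp => //; apply: measurableT_comp => //.
apply: measurable_sum => j; apply: measurable_funM => //.
by apply: measurable_sum => i; exact: measurable_funM.
Qed.

End density_formula.

(** * Integration over paths *)

Section integral_sum_measure.
Local Open Scope ereal_scope.
Context d (U : measurableType d) (R : realType) (I : Type).
Variable m_ : I -> {measure set U -> \bar R}.

(** The dominating measure is a series of sums over tuples of states; such a sum
    over an arbitrary index type is written as iterated [measure_add] in order to
    remain a measure. *)
Fixpoint sum_measure (s : seq I) : {measure set U -> \bar R} :=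
  if s is i :: s' then measure_add (m_ i) (sum_measure s') else mzero.

Lemma sum_measureE s A : sum_measure s A = \sum_(i <- s) m_ i A.
Proof.
elim: s => [|i s IH]; first by rewrite big_nil.
by rewrite big_cons -IH; exact: measure_addE.
Qed.

Lemma ge0_integral_sum_measure s (f : U -> \bar R) :
  measurable_fun setT f -> (forall u, 0 <= f u) ->
  \int[sum_measure s]_u f u = \sum_(i <- s) \int[m_ i]_u f u.
Proof.
move=> mf f0; elim: s => [|i s IH]; first by rewrite big_nil integral_measure_zero.
by rewrite big_cons /= ge0_integral_measure_add// IH.
Qed.

End integral_sum_measure.

Section integral_path_measure.
Local Open Scope ereal_scope.
Context {w : nat} {R : realType} (T : R).
Local Notation borelR := (measurableTypeR R).
Local Notation path := (sample_path w R).
Local Notation mu := (@lebesgue_measure R).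

Lemma integral_lebesgue_tuple1 (g : 1.-tuple borelR -> \bar R) :
  measurable_fun setT g -> (forall t, 0 <= g t) ->
  \int[lebesgue_tuple 1]_t g t = \int[mu]_s g [tuple s].
Proof.
move=> mg g0; rewrite ge0_integral_pushforward//.
have mgc : measurable_fun setT (g \o @cons_pair R 0) by exact: measurableT_comp.
have gc0 x : 0 <= (g \o @cons_pair R 0) x by exact: g0.
rewrite [LHS](fubini_tonelli1 (m1 := \d_([tuple] : 0.-tuple borelR))
  (m2 := mu) _ mgc gc0).
rewrite integral_dirac//; last exact: (measurable_fun_fubini_tonelli_F _ mgc gc0).
rewrite diracT mul1e; apply: eq_integral => s _ /=.
by congr g; apply: val_inj.
Qed.

Lemma integral_path_measure_series (h : path -> \bar R) :
  measurable_fun setT h -> (forall x, 0 <= h x) ->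
  \int[path_measure T]_x h x = \sum_(0 <= m <oo) \sum_(z : m.+1.-tuple 'I_w)
    \int[lebesgue_tuple m]_t h (mk_path T z t).
Proof.
move=> mh h0.
have -> : @path_measure w R T = mseries (fun m => sum_measure
    (fun z : m.+1.-tuple 'I_w => image_measure (@lebesgue_tuple R m) (mk_path T z))
    (index_enum _)) 0.
  by apply/funext => A; apply: eq_eseriesr => m _; rewrite sum_measureE.
rewrite ge0_integral_measure_series//; apply: eq_eseriesr => m _.
rewrite ge0_integral_sum_measure//; apply: eq_bigr => z _.
by rewrite ge0_integral_pushforward.
Qed.

(** Without paths of more than two sojourns, only the series terms for no jump and
    for one jump remain. *)
Lemma integral_path_measure_le1 (h : path -> \bar R) :
  measurable_fun setT h -> (forall x, 0 <= h x) ->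
  (forall x, (2 < size x)%N -> h x = 0) ->
  \int[path_measure T]_x h x = \sum_j h [:: (j, T)] +
    \sum_j \sum_k \int[mu]_s h [:: (j, s); (k, (T - s)%R)].
Proof.
move=> mh h0 hsize; rewrite integral_path_measure_series//.
rewrite (nneseries_split 0 2); last first.
  by move=> m _; apply: sume_ge0 => z _; exact: integral_ge0.
rewrite eseries0 ?adde0; last first.
  move=> m m2 _; rewrite big1// => z _; apply: integral0_eq => t _.
  by rewrite hsize// size_zip size_rcons !size_tuple minnn.
rewrite big_mkord !big_ord_recl big_ord0 adde0 /=; congr (_ + _).
  rewrite (reindex (fun j : 'I_w => [tuple j])) /=; last first.
    exists (fun z : 1.-tuple 'I_w => thead z) => [j _|z _]; first by rewrite theadE.
    by case/tupleP: z => j z; apply: val_inj; rewrite /= theadE (tuple0 z).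
  apply: eq_bigr => j _; rewrite integral_dirac//; last first.
    exact: measurableT_comp.
  by rewrite diracT mul1e /mk_path /= big_nil subr0.
rewrite pair_big/= (reindex (fun jk : 'I_w * 'I_w => [tuple jk.1; jk.2])) /=; last first.
  exists (fun z : 2.-tuple 'I_w => (thead z, thead (behead_tuple z))) => [[j k] _|z _].
    by rewrite !theadE.
  case/tupleP: z => j z; case/tupleP: z => k z; apply: val_inj => /=.
  by rewrite (tuple0 z) !theadE.
apply: eq_bigr => -[j k] _; rewrite integral_lebesgue_tuple1//; last first.
  exact: measurableT_comp.
by apply: eq_integral => s _; rewrite /mk_path /= big_seq1.
Qed.

Lemma measurable_two_sojourns (j k : 'I_w) :
  measurable_fun setT (fun s : borelR => [:: (j, s); (k, T - s)%R] : path).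
Proof.
rewrite (_ : (fun _ => _) = mk_path T [tuple j; k] \o (fun s => [tuple s])).
  apply: measurableT_comp => //; apply/measurable_fun_tnthP => i.
  rewrite (_ : _ \o _ = id)//; apply/funext => s /=.
  by rewrite (ord1 i) (tnth_nth s).
by apply/funext => s; rewrite /= /mk_path /= big_seq1.
Qed.

End integral_path_measure.

Lemma integral_exponential_oo (R : realType) (c T : R) : 0 < c -> 0 < T ->
  (\int[lebesgue_measure]_(s in `]0%R, T[) (c * expR (- (c * s)))%:E =
   (1 - expR (- (c * T)))%:E)%E.
Proof.
move=> c0 T0; transitivity (exponential_prob c `[0, T]); last first.
  by rewrite exponential_prob_itv0c// mulNr.
rewrite /exponential_prob (@integral_itv_bndoo _ 0 T _ true false); last first.
  apply: measurable_funTS; apply/measurable_EFinP.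
  exact: (measurable_exponential_pdf c).
apply: eq_integral => s; rewrite inE/= in_itv/= => /andP[s0 _].
by rewrite exponential_pdfE ?ltW// mulNr.
Qed.

(** * A component that jumps at most once *)

Lemma integral_indic_exponential (R : realType) (K c T : R) :
  0 <= K -> 0 < c -> 0 < T ->
  (\int[lebesgue_measure]_s
     (\1_(`]0%R, T[ : set R) s * (K * (c * expR (- (c * s)))))%:E =
   (K * (1 - expR (- (c * T))))%:E)%E.
Proof.
move=> K0 c0 T0; rewrite EFinM -integral_exponential_oo// -ge0_integralZl//; last 2 first.
- apply: measurable_funTS; apply/measurable_EFinP.
  apply: measurable_funM => //; apply: measurableT_comp => //.
  by apply: measurableT_comp => //; exact: measurable_funM.
- by move=> s _; rewrite lee_fin mulr_ge0 ?expR_ge0// ltW.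
rewrite [RHS]integral_mkcond; apply: eq_integral => s _.
rewrite patchE indicE; case: ifPn => _; first by rewrite mul1r.
by rewrite mul0r.
Qed.

Lemma indic_itvoo (R : realType) (a b s : R) :
  \1_(`]a, b[ : set R) s = ((a < s) && (s < b))%:R :> R.
Proof.
by rewrite indicE; congr ((nat_of_bool _)%:R); apply/idP/idP; rewrite inE/= in_itv.
Qed.

Section fast_exit.
Context {w : nat} {R : realType}.
Variables (T : R) (gamma : 'M[R]_w) (alpha0 beta0 : 'I_w -> R) (j0 : 'I_w).
Hypotheses (T_gt0 : 0 < T) (gammaP : is_transition gamma).
Hypothesis theta0P : is_param gamma (alpha0, beta0).
Hypotheses (alpha0_gt0 : 0 < alpha0 j0) (beta0_gt0 : 0 < beta0 j0).
Local Notation path := (sample_path w R).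
Local Notation f0 := (path_density T gamma (alpha0, beta0)).

Let gamma_ge0 j k : 0 <= gamma j k. Proof. by have [] := gammaP. Qed.
Let gamma_diag j : gamma j j = 0. Proof. by have [] := gammaP. Qed.
Let alpha0_ge0 j : 0 <= alpha0 j. Proof. by have [[]] := theta0P. Qed.
Let beta0_ge0 j : 0 <= beta0 j. Proof. by have [_ /(_ j)[]] := theta0P. Qed.

Let gamma_j0 : \sum_k gamma j0 k = 1.
Proof.
have [_ _ /(_ j0)[//|row0]] := gammaP.
have [_ /(_ j0)[_ /(_ row0) b0]] := theta0P.
by move: beta0_gt0; rewrite (b0 : beta0 j0 = 0) ltxx.
Qed.

Definition fast_exit_param (b : R) : ('I_w -> R) * ('I_w -> R) :=
  (fun j => (j == j0)%:R, fun j => (j == j0)%:R * b).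

Lemma fast_exit_paramP b : 0 <= b -> is_param gamma (fast_exit_param b).
Proof.
move=> b0; split; split => /=.
- by move=> j; rewrite ler0n.
- by rewrite (bigD1 j0)//= eqxx big1 ?addr0// => j /negbTE ->.
- by rewrite mulr_ge0.
- case: eqVneq => [->|_ _]; last by rewrite mul0r.
  move=> row0; exfalso; move: gamma_j0; rewrite big1 => [/eqP|k _]//.
  by rewrite eq_sym oner_eq0.
Qed.

(** Under [fast_exit_param b] the chain leaves [j0] at rate [b] and then stays for
    ever in the state that it enters. Cutting the density off at two sojourns
    therefore loses no mass (see [integral_fast_exit_density]), and keeps all
    integrals explicit. *)
Definition fast_exit_density (b : R) (x : path) : R :=
  if (size x <= 2)%N then path_density T gamma (fast_exit_param b) x else 0.

Lemma fast_exit_density_ge0 b x : 0 <= b -> 0 <= fast_exit_density b x.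
Proof.
move=> b0; rewrite /fast_exit_density; case: ifP => // _.
by apply: path_density_ge0 => j /=; rewrite ?mulr_ge0.
Qed.

Lemma fast_exit_density_le b x : 0 <= b ->
  fast_exit_density b x <= path_density T gamma (fast_exit_param b) x.
Proof.
move=> b0; rewrite /fast_exit_density; case: ifP => // _.
by apply: path_density_ge0 => j /=; rewrite ?mulr_ge0.
Qed.

Lemma measurable_fast_exit_density b : measurable_fun setT (fast_exit_density b).
Proof.
apply: measurable_fun_sample_path => m z.
have [m2|m2] := leqP m 2.
  rewrite (_ : (fun _ => _) = (path_density T gamma (fast_exit_param b)) \o
      (fun t : m.-tuple (measurableTypeR R) => zip z t)); last first.
    by apply/funext => t; rewrite /fast_exit_density/= size_zip !size_tuple minnn m2.
  have mf := measurable_path_density T gamma (fast_exit_param b).1 (fast_exit_param b).2.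
  exact: measurableT_comp mf (measurable_zip z).
rewrite (_ : (fun _ => _) = fun=> 0)//; apply/funext => t.
by rewrite /fast_exit_density size_zip !size_tuple minnn leqNgt m2.
Qed.

Lemma fast_exit_density1 b j :
  fast_exit_density b [:: (j, T)] = (j == j0)%:R * expR (- (b * T)).
Proof.
rewrite [LHS]path_density1//=.
by case: eqVneq => _; rewrite ?mul1r// !mul0r.
Qed.

Lemma fast_exit_density2 b j k s :
  fast_exit_density b [:: (j, s); (k, T - s)] =
  (j == j0)%:R * (\1_(`]0, T[ : set R) s * (gamma j0 k * (b * expR (- (b * s))))).
Proof.
rewrite [LHS]path_density2//=.
have [-> | _] := eqVneq j j0; last by rewrite !mul0r mulr0.
rewrite !mul1r /is_path /= big_cons big_seq1 /= subrKC eqxx !andbT /=.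
rewrite indic_itvoo subr_gt0.
have [s01|_] := boolP ((0 < s) && (s < T)); last by rewrite !mul0r.
rewrite !mul1r /=; have [g0|] := ltP 0 (gamma j0 k).
  have kj : k != j0 by apply: contraTneq g0 => ->; rewrite gamma_diag ltxx.
  by rewrite (negbTE kj) mul0r mul0r addr0 mul1r mulrCA mulrA.
by move=> g0; have -> : gamma j0 k = 0 by [apply/eqP; rewrite eq_le g0 gamma_ge0];
  rewrite !mul0r.
Qed.

(** With at most one jump before [T] the null density cannot be small: it is at
    least its initial and jump factors times [expR (- (B * T))], where [B] is the
    sum of all rates. *)
Lemma fast_exit_density_dominated b : 0 <= b ->
  exists2 C, 0 <= C & forall x, fast_exit_density b x <= C * f0 x.
Proof.
move=> b0; pose B := \sum_j beta0 j.
have betaB j : beta0 j <= B.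
  by rewrite /B (bigD1 j)//= lerDl; apply: sumr_ge0.
have f0_ge0 x : 0 <= f0 x by exact: path_density_ge0.
have a_gt0 := alpha0_gt0; have be_gt0 := beta0_gt0.
set a := alpha0 j0 in a_gt0 *; set be := beta0 j0 in be_gt0 *.
have abe : 0 < a * be by rewrite mulr_gt0.
pose C := (a^-1 + b / (a * be)) * expR (B * T).
have C0 : 0 <= C.
  by rewrite mulr_ge0 ?expR_ge0// addr_ge0 ?invr_ge0 ?divr_ge0// ltW.
exists C => // x.
have [xP|xN] := boolP (is_path T gamma x); last first.
  apply: (le_trans (fast_exit_density_le _ b0)).
  by rewrite /f0 !path_densityE (negbTE xN) !mul0r mulr0.
case: x xP => [|[j s] [|[k u] [|e x]]] xP; last first.
- by rewrite (_ : fast_exit_density b _ = 0)// mulr_ge0.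
- have uE : u = T - s.
    case/and3P: xP => _ /eqP <- _.
    by rewrite big_cons big_seq1/= addrC addKr.
  move: xP; rewrite uE => xP; rewrite fast_exit_density2.
  have [jj0|_] := eqVneq j j0; last by rewrite mul0r mulr_ge0.
  rewrite path_density2// xP !mul1r jj0 -/a -/be.
  case/and3P: xP => /= /and3P[s0 u0 _] _ _.
  have h1 : \1_(`]0, T[ : set R) s * (gamma j0 k * (b * expR (- (b * s)))) <=
      gamma j0 k * b.
    apply: (@le_trans _ _ (1 * (gamma j0 k * (b * 1)))); last by rewrite mul1r mulr1.
    have e1 : expR (- (b * s)) <= 1 by rewrite -expR0 ler_expR oppr_le0 mulr_ge0// ltW.
    have gb : gamma j0 k * (b * expR (- (b * s))) <= gamma j0 k * (b * 1).
      by rewrite !ler_wpM2l.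
    apply: ler_pM => //.
      by rewrite !mulr_ge0 ?expR_ge0.
  apply: (le_trans h1).
  have h2 : expR (- (B * T)) <= expR (- (be * s + beta0 k * (T - s))).
    rewrite ler_expR lerN2 (_ : B * T = B * s + B * (T - s)); last by ring.
    apply: lerD; apply: ler_wpM2r; [exact: ltW|exact: betaB|exact: ltW|exact: betaB].
  have h3 : gamma j0 k * b = b / (a * be) * expR (B * T) *
      (a * (be * gamma j0 k * expR (- (B * T)))).
    rewrite (_ : _ * (a * _) = b * gamma j0 k * ((a * be) / (a * be)) *
      (expR (B * T) * expR (- (B * T)))); last by ring.
    by rewrite divff ?gt_eqF// -expRD subrr expR0 !mulr1 mulrC.
  rewrite h3; apply: ler_pM.
  + by rewrite mulr_ge0 ?expR_ge0// divr_ge0// ltW.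
  + by rewrite !mulr_ge0 ?expR_ge0// ltW.
  + by rewrite ler_wpM2r ?expR_ge0// lerDr invr_ge0 ltW.
  + by do 2 (apply: ler_wpM2l; first by rewrite ?mulr_ge0 ?(ltW a_gt0) ?(ltW be_gt0)).
- have sE : s = T by case/and3P: xP => _ /eqP <- _; rewrite big_seq1.
  rewrite sE fast_exit_density1 path_density1//.
  have [jj0|_] := eqVneq j j0; last by rewrite mul0r mulr_ge0// mulr_ge0 ?expR_ge0.
  rewrite mul1r jj0 -/a -/be.
  apply: (@le_trans _ _ 1); first by rewrite -expR0 ler_expR oppr_le0 mulr_ge0// ltW.
  have h2 : expR (- (B * T)) <= expR (- (be * T)).
    by rewrite ler_expR lerN2; apply: ler_wpM2r; [exact: ltW|exact: betaB].
  have -> : 1 = a^-1 * expR (B * T) * (a * expR (- (B * T))).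
    by rewrite mulrACA -expRD subrr expR0 mulVf ?mulr1// gt_eqF.
  apply: ler_pM.
  + by rewrite mulr_ge0 ?expR_ge0// invr_ge0 ltW.
  + by rewrite mulr_ge0 ?expR_ge0// ltW.
  + by rewrite ler_wpM2r ?expR_ge0// lerDl divr_ge0// ltW.
  + by rewrite ler_wpM2l// ltW.
- by rewrite [leLHS]path_densityE /initial_weight mul0r mulr0 mulr_ge0.
Qed.

Lemma integral_fast_exit_density b : 0 < b ->
  (\int[path_measure T]_x (fast_exit_density b x)%:E = 1)%E.
Proof.
move=> b0; rewrite integral_path_measure_le1; last 3 first.
- by apply/measurable_EFinP; exact: measurable_fast_exit_density.
- by move=> x; rewrite lee_fin fast_exit_density_ge0// ltW.
- by move=> x x2; rewrite /fast_exit_density leqNgt x2.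
rewrite (bigD1 j0)//= big1 ?adde0; last first.
  by move=> j /negbTE jj0; rewrite fast_exit_density1 jj0 mul0r.
rewrite (bigD1 j0)//= [X in (_ + (_ + X))%E]big1 ?adde0; last first.
  move=> j /negbTE jj0; rewrite big1// => k _; rewrite integral0_eq// => s _.
  by rewrite fast_exit_density2 jj0 mul0r.
rewrite fast_exit_density1 eqxx mul1r.
under eq_bigr => k _.
  under eq_integral do rewrite fast_exit_density2 eqxx mul1r.
  rewrite integral_indic_exponential//.
  over.
rewrite sumEFin -mulr_suml gamma_j0 mul1r -EFinD.
by rewrite addrC subrK.
Qed.

Lemma measurable_fast_exit_ratio b :
  measurable_fun setT (fun x => fast_exit_density b x / f0 x).
Proof.
apply: measurable_funM; first exact: measurable_fast_exit_density.
rewrite (_ : (fun x => _) = (fun y => y `^ (-1)) \o f0); last first.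
  by apply/funext => x; rewrite /= powR_inv1//; exact: path_density_ge0.
apply: measurableT_comp; first exact: measurable_powR.
exact: measurable_path_density.
Qed.

(** After one jump at time [s] the null density is at most
    [alpha0 j0 * beta0 j0 * gamma j0 k], so that the ratio is at least of order
    [b * expR (- (b * s))]; its square integrates to order [b]. *)
Lemma fast_exit_second_moment b : 0 < b ->
  ((b / (2 * alpha0 j0 * beta0 j0) * (1 - expR (- (2 * b * T))))%:E <=
   \int[path_measure T]_x
     (fast_exit_density b x / f0 x * fast_exit_density b x)%:E)%E.
Proof.
move=> b0; have a_gt0 := alpha0_gt0; have be_gt0 := beta0_gt0.
set a := alpha0 j0 in a_gt0 *; set be := beta0 j0 in be_gt0 *.
have abe : 0 < a * be by rewrite mulr_gt0.
have f0_ge0 x : 0 <= f0 x by exact: path_density_ge0.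
have g0 x : 0 <= fast_exit_density b x by rewrite fast_exit_density_ge0// ltW.
rewrite integral_path_measure_le1; last 3 first.
- apply/measurable_EFinP; apply: measurable_funM.
    exact: measurable_fast_exit_ratio.
  exact: measurable_fast_exit_density.
- by move=> x; rewrite lee_fin mulr_ge0// divr_ge0.
- by move=> x x2; rewrite /fast_exit_density leqNgt x2 mulr0.
set r := fun x : path => (fast_exit_density b x / f0 x * fast_exit_density b x)%:E.
have r0 x : (0 <= r x)%E by rewrite lee_fin mulr_ge0// divr_ge0.
rewrite -[leLHS]add0e; apply: leeD; first by apply: sume_ge0 => j _; exact: r0.
rewrite (bigD1 j0)//= -[leLHS]adde0; apply: leeD; last first.
  apply: sume_ge0 => j _; apply: sume_ge0 => k _.
  by apply: integral_ge0 => s _; exact: r0.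
have -> : b / (2 * a * be) * (1 - expR (- (2 * b * T))) =
    \sum_k gamma j0 k * (b / (2 * a * be) * (1 - expR (- (2 * b * T)))).
  by rewrite -mulr_suml gamma_j0 mul1r.
rewrite -sumEFin; apply: lee_sum => k _.
have K0 : 0 <= gamma j0 k * (b / (2 * a * be)).
  by rewrite mulr_ge0// divr_ge0 ?(ltW b0)// -mulrA mulr_ge0// ltW.
have bb0 : 0 < 2 * b by rewrite mulr_gt0.
rewrite [_ * (_ * (1 - _))]mulrA -integral_indic_exponential//.
have pointwise (s : R) :
    \1_(`]0, T[ : set R) s * (gamma j0 k * (b / (2 * a * be)) *
      (2 * b * expR (- (2 * b * s)))) <=
    fast_exit_density b [:: (j0, s); (k, T - s)] / f0 [:: (j0, s); (k, T - s)] *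
      fast_exit_density b [:: (j0, s); (k, T - s)].
  rewrite fast_exit_density2 eqxx mul1r.
  rewrite indic_itvoo; have [/andP[s0 sT]|_] := boolP ((0 < s) && (s < T)); last first.
    by rewrite !mul0r.
  have [gk|gk] := ltP 0 (gamma j0 k); last first.
    have -> : gamma j0 k = 0 by apply/eqP; rewrite eq_le gk gamma_ge0.
    by rewrite !(mul0r, mulr0).
  rewrite !mul1r path_density2//.
  have -> : is_path T gamma [:: (j0, s); (k, T - s)].
    rewrite /is_path/= s0 subr_gt0 sT gk !andbT /= big_cons big_seq1/=.
    by rewrite subrKC eqxx.
  rewrite mul1r -/a -/be; set q := be * s + _.
  have q0 : 0 <= q.
    apply: addr_ge0; apply: mulr_ge0; rewrite ?subr_ge0; exact: ltW || exact: beta0_ge0.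
  set e := expR (- (b * s)); set f := expR (- q).
  have -> : expR (- (2 * b * s)) = e * e by rewrite -expRD; congr expR; ring.
  have e0 : 0 < e by exact: expR_gt0.
  have f1 : f^-1 >= 1 by rewrite -expRN opprK -expR0 ler_expR.
  have -> : gamma j0 k * (b / (2 * a * be)) * (2 * b * (e * e)) =
      gamma j0 k * (b * e) / (a * (be * gamma j0 k)) * (gamma j0 k * (b * e)).
    by field; rewrite !gt_eqF.
  rewrite ler_wpM2r ?mulr_ge0 ?(ltW b0) ?(ltW e0)//.
  rewrite ler_wpM2l ?mulr_ge0 ?(ltW b0) ?(ltW e0)//.
  rewrite (_ : a * (be * _ * f) = a * (be * gamma j0 k) * f); last by ring.
  by rewrite [leRHS]invfM ler_peMr// invr_ge0 ltW// !mulr_gt0.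
have mtwo : measurable_fun setT
    (fun s : measurableTypeR R => r [:: (j0, s); (k, T - (s : R))]).
  apply: (measurableT_comp (f := r)); last exact: measurable_two_sojourns.
  apply/measurable_EFinP; apply: measurable_funM.
    exact: measurable_fast_exit_ratio.
  exact: measurable_fast_exit_density.
apply: ge0_le_integral => //.
- move=> s _; rewrite lee_fin mulr_ge0 ?indicE//.
  by rewrite mulr_ge0// mulr_ge0 ?expR_ge0// ltW.
- apply/measurable_EFinP; apply: measurable_funM; first exact: measurable_indic.
  apply: measurable_funM => //; apply: measurable_funM => //.
  apply: measurableT_comp => //.
  by apply: measurableT_comp => //; exact: measurable_funM.
by move=> s _; rewrite lee_fin; exact: pointwise.
Qed.

End fast_exit.

(** * The event that the likelihood ratio statistic is bounded *)

Lemma lneM_ge0 (R : realType) (a b : R) : 0 <= a -> 0 <= b ->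
  lne (a * b)%:E = (lne a%:E + lne b%:E)%E.
Proof.
move=> a0 b0; have lne0 : lne (0 : R)%:E = -oo%E by rewrite le0_lneNy.
have [->|an0] := eqVneq a 0; first by rewrite mul0r lne0 addNye.
have [->|bn0] := eqVneq b 0; first by rewrite mulr0 lne0 addeNy.
have a_gt0 : 0 < a by rewrite lt_def an0.
have b_gt0 : 0 < b by rewrite lt_def bn0.
by rewrite !lne_EFin// ?mulr_gt0// lnM.
Qed.

Lemma sum_lne (R : realType) n (y : 'I_n -> R) : (forall i, 0 <= y i) ->
  (\sum_(i < n) lne (y i)%:E = lne (\prod_(i < n) y i)%:E)%E.
Proof.
elim: n y => [|n IH] y y0; first by rewrite !big_ord0 lne1.
by rewrite !big_ord_recr IH// [RHS]lneM_ge0//; exact: prodr_ge0.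
Qed.

Section likelihood_ratio_event.
Context {w : nat} {R : realType}.
Variables (T : R) (gamma : 'M[R]_w).
Implicit Types (x : nat -> sample_path w R) (theta : ('I_w -> R) * ('I_w -> R)).

Definition mixture_lik theta0 n x (p : R) theta : R :=
  \prod_(i < n) ((1 - p) * path_density T gamma theta0 (x i) +
                 p * path_density T gamma theta (x i)).

Definition null_lik theta0 n x : R :=
  \prod_(i < n) path_density T gamma theta0 (x i).

Lemma is_param_density_ge0 theta y : is_param gamma theta ->
  0 <= path_density T gamma theta y.
Proof.
by case: theta => a b [[a0 _] b0]; apply: path_density_ge0 => // j; case: (b0 j).
Qed.

(** When the null likelihood vanishes, the statistic is [+oo] unless every mixture
    likelihood vanishes as well, in which case it is [-oo] (as [-oo + +oo = -oo]);
    the right-hand side says the same. *)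
Lemma loglik_ratio_leP theta0 n x (M : R) : is_param gamma theta0 ->
  (loglik_ratio T gamma theta0 n x <= M%:E)%E <->
  (forall p theta, 0 <= p <= 1 -> is_param gamma theta ->
     mixture_lik theta0 n x p theta <= expR M * null_lik theta0 n x).
Proof.
move=> theta0P; rewrite /loglik_ratio sum_lne; last first.
  by move=> i; exact: is_param_density_ge0.
rewrite -/(null_lik theta0 n x); set S := [set _ | _ in _].
have F0 : 0 <= null_lik theta0 n x.
  by apply: prodr_ge0 => i _; exact: is_param_density_ge0.
have mixE p theta : 0 <= p <= 1 -> is_param gamma theta ->
    mixture_loglik T gamma theta0 n x p theta =
      lne (mixture_lik theta0 n x p theta)%:E /\ 0 <= mixture_lik theta0 n x p theta.
  move=> /andP[p0 p1] thetaP.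
  have mix0 i : 0 <= (1 - p) * path_density T gamma theta0 (x i) +
                 p * path_density T gamma theta (x i).
    by rewrite addr_ge0// mulr_ge0 ?subr_ge0//; exact: is_param_density_ge0.
  by rewrite /mixture_loglik sum_lne//; split => //; exact: prodr_ge0.
have supP (c : \bar R) : (ereal_sup S <= c)%E <->
    forall p theta, 0 <= p <= 1 -> is_param gamma theta ->
      (lne (mixture_lik theta0 n x p theta)%:E <= c)%E.
  split=> [Sc p theta p01 thetaP|H].
    have [<- _] := mixE _ _ p01 thetaP.
    by apply: le_trans Sc; apply: ereal_sup_ubound; exists (p, theta).
  apply: ge_ereal_sup => _ [[p theta]/= [p01 thetaP] <-].
  by have [-> _] := mixE _ _ p01 thetaP; exact: H.
have [F00|F_neq0] := eqVneq (null_lik theta0 n x) 0.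
  rewrite F00 mulr0 le0_lneNy//= ; split=> [supM p theta p01 thetaP|H].
    rewrite leNgt; apply/negP => mix_gt0.
    have /supP/(_ p theta p01 thetaP) : (ereal_sup S <= -oo)%E.
      by rewrite leeNy_eq; case: (ereal_sup S) supM.
    by rewrite lne_EFin.
  have : (ereal_sup S <= -oo)%E.
    by apply/supP => p theta p01 thetaP; rewrite le0_lneNy// lee_fin H.
  by rewrite leeNy_eq => /eqP ->; rewrite addNye leNye.
have F_gt0 : 0 < null_lik theta0 n x by rewrite lt_def F_neq0.
have eF : 0 < expR M * null_lik theta0 n x by rewrite mulr_gt0 ?expR_gt0.
rewrite lne_EFin// leeBlDr//.
have -> : (M%:E + (ln (null_lik theta0 n x))%:E)%E =
    lne (expR M * null_lik theta0 n x)%:E.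
  by rewrite lne_EFin// lnM ?posrE ?expR_gt0// expRK.
have in0 (y : R) : 0 <= y -> y%:E \in `[0%E, +oo%E].
  by move=> y0; rewrite in_itv/= lee_fin leey andbT.
have mono y : 0 <= y -> (lne y%:E <= lne (expR M * null_lik theta0 n x)%:E)%E =
    (y <= expR M * null_lik theta0 n x).
  by move=> y0; rewrite lee_lne ?lee_fin//; apply: in0 => //; exact: ltW.
split=> [/supP H p theta p01 thetaP|H].
  have [_ m0] := mixE _ _ p01 thetaP.
  by rewrite -mono//; exact: H.
apply/supP => p theta p01 thetaP; have [_ m0] := mixE _ _ p01 thetaP.
by rewrite mono//; exact: H.
Qed.

Lemma cvg_path_density (alpha_ beta_ : nat -> 'I_w -> R) (alpha beta : 'I_w -> R)
    (y : sample_path w R) :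
  (forall j, alpha_ ^~ j @ \oo --> alpha j) ->
  (forall j, beta_ ^~ j @ \oo --> beta j) ->
  path_density T gamma (alpha_ k, beta_ k) y @[k --> \oo] -->
  path_density T gamma (alpha, beta) y.
Proof.
move=> ca cb; under eq_cvg do rewrite path_densityE.
rewrite path_densityE; apply: cvgM; first exact: cvg_cst.
apply: cvgM.
  by rewrite /initial_weight; case: (ohead _) => [j|] /=; [exact: ca|exact: cvg_cst].
apply: cvgM.
  apply: continuous_cvg; first exact: continuous_expR.
  apply: cvgN; apply: cvg_big => [|j _]; first exact: add_continuous.
  by apply: cvgM => //; exact: cvg_cst.
apply: cvg_big => [|j _]; first exact: mul_continuous.
apply: cvg_big => [|k _]; first exact: mul_continuous.
apply: cvgM; last exact: cvg_cst.
by apply: (@cvg_comp _ _ _ _ (fun z => z ^+ _) _ _ _ (cb j)); exact: exprn_continuous.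
Qed.

End likelihood_ratio_event.

(** * Reduction to countably many parameters *)

Section grid.
Context {R : realType}.

Definition grid_point (k a : nat) : R := a%:R / k.+1%:R.

Definition grid_index (k : nat) (y : R) : nat := Num.truncn (y * k.+1%:R).

Definition grid_round k y := grid_point k (grid_index k y).

Lemma grid_round_ge0 k y : 0 <= grid_round k y.
Proof. by rewrite divr_ge0. Qed.

Lemma grid_round_le k y : 0 <= y -> grid_round k y <= y.
Proof. by move=> y0; rewrite ler_pdivrMr// truncn_le mulr_ge0. Qed.

Lemma grid_round0 k : grid_round k 0 = 0.
Proof. by rewrite /grid_round /grid_index mul0r truncn0 /grid_point mul0r. Qed.

Lemma cvg_grid_round y : 0 <= y -> grid_round k y @[k --> \oo] --> y.
Proof.
move=> y0; apply: (@squeeze_cvgr _ _ _ _ (fun k => y - k.+1%:R^-1) (fun=> y)).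
- near=> k; rewrite grid_round_le// andbT lerBlDr /grid_round /grid_point.
  by rewrite -[X in _ + X]mul1r -mulrDl ler_pdivlMr// natr1 ltW// truncnS_gt.
- rewrite -[X in _ --> X]subr0; apply: cvgB; first exact: cvg_cst.
  exact: cvg_harmonic.
- exact: cvg_cst.
Unshelve. all: by end_near. Qed.

End grid.

Section countable_supremum.
Context {w : nat} {R : realType}.
Variables (T : R) (gamma : 'M[R]_w) (theta0 : ('I_w -> R) * ('I_w -> R)).
Hypotheses (w_gt0 : (0 < w)%N) (theta0P : is_param gamma theta0).

(** Denominator minus one, then the numerators of the weight, of the initial
    distribution and of the rates. *)
Definition grid_code : Type := nat * nat * {ffun 'I_w -> nat} * {ffun 'I_w -> nat}.

(** The mass that rounding down takes away from a distribution is spread evenly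
    over the states, so that a rounded distribution is a distribution. *)
Definition grid_param (c : grid_code) : R * (('I_w -> R) * ('I_w -> R)) :=
  let: (k, p, a, b) := c in
  (grid_point k p,
   (fun j => grid_point k (a j) + (1 - \sum_i grid_point k (a i)) / w%:R,
    fun j => grid_point k (b j))).

Definition admissible (q : R * (('I_w -> R) * ('I_w -> R))) : Prop :=
  0 <= q.1 <= 1 /\ is_param gamma q.2.

Definition round_code (k : nat) (q : R * (('I_w -> R) * ('I_w -> R))) : grid_code :=
  (k, grid_index k q.1, [ffun j => grid_index k (q.2.1 j)],
   [ffun j => grid_index k (q.2.2 j)]).

Lemma round_codeE k q : grid_param (round_code k q) =
  (grid_round k q.1,
   (fun j => grid_round k (q.2.1 j) + (1 - \sum_i grid_round k (q.2.1 i)) / w%:R,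
    fun j => grid_round k (q.2.2 j))).
Proof.
congr (_, (_, _)); apply/funext => j; rewrite ffunE//.
by congr (_ + (1 - _) / _); apply: eq_bigr => i _; rewrite ffunE.
Qed.

Lemma admissible_round k q : admissible q -> admissible (grid_param (round_code k q)).
Proof.
rewrite round_codeE; case: q => p [a b] [/andP[/= p0 p1] [[/= a0 a1] bP]].
have w0 : w%:R != 0 :> R by rewrite pnatr_eq0 -lt0n.
split=> /=; first by rewrite grid_round_ge0 (le_trans (grid_round_le _ p0)).
split; split => /=.
- move=> j; rewrite addr_ge0 ?grid_round_ge0// divr_ge0// subr_ge0 -a1.
  by apply: ler_sum => i _; exact: grid_round_le.
- by rewrite big_split/= sumr_const card_ord -[_ *+ w]mulr_natr divfK// subrKC.
- exact: grid_round_ge0.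
- by move=> row0; rewrite (bP j).2// grid_round0.
Qed.

(** Rounded parameters are admissible and converge to the given ones, along which
    the mixture likelihood converges. Rounding down also preserves the zero
    rates of absorbing states. *)
Lemma mixture_lik_le_grid n x (c : R) :
  (forall g : grid_code, admissible (grid_param g) ->
     mixture_lik T gamma theta0 n x (grid_param g).1 (grid_param g).2 <= c) ->
  forall p theta, 0 <= p <= 1 -> is_param gamma theta ->
     mixture_lik T gamma theta0 n x p theta <= c.
Proof.
move=> gc p [a b] p01 thetaP.
have qP : admissible (p, (a, b)) by [].
have [[/= a0 a1] bP] := thetaP; have /andP[p0 p1] := p01.
pose q k := grid_param (round_code k (p, (a, b))).
have cp : (q k).1 @[k --> \oo] --> p.
  have -> : (fun k => (q k).1) = fun k => grid_round k p.
    by apply/funext => k; rewrite /q round_codeE.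
  exact: cvg_grid_round.
have cb j : (q k).2.2 j @[k --> \oo] --> b j.
  have -> : (fun k => (q k).2.2 j) = fun k => grid_round k (b j).
    by apply/funext => k; rewrite /q round_codeE.
  by apply: cvg_grid_round; case: (bP j).
have ca j : (q k).2.1 j @[k --> \oo] --> a j.
  have -> : (fun k => (q k).2.1 j) = fun k =>
      grid_round k (a j) + (1 - \sum_i grid_round k (a i)) / w%:R.
    by apply/funext => k; rewrite /q round_codeE.
  rewrite [X in _ --> X](_ : _ = a j + (1 - \sum_i a i) / w%:R); last first.
    by rewrite a1 subrr mul0r addr0.
  apply: cvgD; first exact: cvg_grid_round.
  apply: cvgM; last exact: cvg_cst.
  apply: cvgB; first exact: cvg_cst.
  apply: cvg_big => [|i _]; first exact: add_continuous.
  exact: cvg_grid_round.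
have H : mixture_lik T gamma theta0 n x (q k).1 (q k).2 @[k --> \oo] -->
    mixture_lik T gamma theta0 n x p (a, b).
  apply: cvg_big => [|i _]; first exact: mul_continuous.
  apply: cvgD.
    apply: cvgM; last exact: cvg_cst.
    by apply: cvgB => //; exact: cvg_cst.
  apply: cvgM => //.
  have -> : (fun k => path_density T gamma (q k).2 (x i)) =
      fun k => path_density T gamma ((q k).2.1, (q k).2.2) (x i).
    by apply/funext => k; rewrite -surjective_pairing.
  exact: cvg_path_density.
rewrite -(cvg_lim _ H)//; apply: limr_le; first by apply/cvg_ex; eexists; exact: H.
by near=> k; apply: gc; exact: admissible_round.
Unshelve. all: by end_near. Qed.

Lemma measurable_loglik_ratio_le d (Omega : measurableType d)
    (X : nat -> Omega -> sample_path w R) n (M : R) :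
  (forall i, measurable_fun setT (X i)) ->
  measurable [set omega |
    (loglik_ratio T gamma theta0 n (X ^~ omega) <= M%:E)%E].
Proof.
move=> mX.
have mden theta i :
    measurable_fun setT (fun omega => path_density T gamma theta (X i omega)).
  case: theta => a b; apply: measurableT_comp (mX i).
  exact: measurable_path_density.
pose S (c : grid_code) := [set omega |
  mixture_lik T gamma theta0 n (X ^~ omega) (grid_param c).1 (grid_param c).2 <=
  expR M * null_lik T gamma theta0 n (X ^~ omega)].
have mS c : measurable (S c).
  rewrite -[S c]setTI; apply: measurable_fun_le => //.
    apply: measurable_prod => i _; apply: measurable_funD; exact: measurable_funM.
  by apply: measurable_funM => //; exact: measurable_prod.
rewrite (_ : [set _ | _] = \bigcap_(k in [set: nat])
    (if unpickle k is Some c then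
       if `[< admissible (grid_param c) >] then S c else setT
     else setT)).
  apply: bigcapT_measurable => k; case: unpickle => // c.
  by case: ifP => // _; exact: mS.
apply/seteqP; split => omega /=.
  move=> /(loglik_ratio_leP _ _ _ _ theta0P) H k _.
  case: unpickle => // c; case: asboolP => // -[p01 thetaP].
  exact: H.
move=> H; apply/(loglik_ratio_leP _ _ _ _ theta0P).
apply: mixture_lik_le_grid => c cP.
by have := H (pickle c) I; rewrite pickleK asboolT.
Qed.

End countable_supremum.

(** * Divergence of the statistic *)

Section fast_exit_ratio.
Context {w : nat} {R : realType}.
Variables (T : R) (gamma : 'M[R]_w) (alpha0 beta0 : 'I_w -> R) (j0 : 'I_w).
Hypotheses (T_gt0 : 0 < T) (gammaP : is_transition gamma).
Hypothesis theta0P : is_param gamma (alpha0, beta0).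
Hypotheses (alpha0_gt0 : 0 < alpha0 j0) (beta0_gt0 : 0 < beta0 j0).
Local Notation path := (sample_path w R).
Local Notation f0 := (path_density T gamma (alpha0, beta0)).
Variable nu : probability path R.
Hypothesis nuE : forall A, measurable A ->
  nu A = (\int[path_measure T]_(x in A) (f0 x)%:E)%E.

Definition fast_exit_ratio b (x : path) : R :=
  fast_exit_density T gamma j0 b x / f0 x.

Let f0_ge0 x : 0 <= f0 x.
Proof. exact: is_param_density_ge0. Qed.

Lemma fast_exit_ratioK b x : 0 <= b ->
  fast_exit_ratio b x * f0 x = fast_exit_density T gamma j0 b x.
Proof.
move=> b0; have [f00|f0_neq0] := eqVneq (f0 x) 0; last by rewrite divfK.
have [C _ /(_ x)] := fast_exit_density_dominated T_gt0 gammaP theta0P alpha0_gt0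
  beta0_gt0 b0.
rewrite f00 !mulr0 => g0; apply/eqP; rewrite eq_le g0 andbT.
exact: fast_exit_density_ge0.
Qed.

Lemma fast_exit_ratio_ge0 b x : 0 <= b -> 0 <= fast_exit_ratio b x.
Proof. by move=> b0; rewrite divr_ge0//; exact: fast_exit_density_ge0. Qed.

Lemma bounded_measurable_fast_exit_ratio b : 0 <= b ->
  bounded_measurable (fast_exit_ratio b).
Proof.
move=> b0; split; first exact: measurable_fast_exit_ratio.
have [C C0 gC] := fast_exit_density_dominated T_gt0 gammaP theta0P alpha0_gt0
  beta0_gt0 b0.
exists C => x; rewrite ger0_norm ?fast_exit_ratio_ge0//.
have [f00|f0_neq0] := eqVneq (f0 x) 0.
  by rewrite /fast_exit_ratio f00 invr0 mulr0.
by rewrite ler_pdivrMr// lt_def f0_neq0 f0_ge0.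
Qed.

(** Means under the law of an observation are integrals over paths against the
    null density. *)
Let mean_against_density (g : path -> R) : bounded_measurable g ->
  (forall x, 0 <= g x) ->
  (mean nu g)%:E = (\int[path_measure T]_x (g x * f0 x)%:E)%E.
Proof.
move=> bg g0; rewrite -mean_EFin//.
have mf0 := measurable_path_density T gamma alpha0 beta0.
have mg : measurable_fun setT (EFin \o g).
  by apply/measurable_EFinP; case: bg.
have eg0 x : (0 <= (EFin \o g) x)%E by rewrite lee_fin.
exact: (ge0_integral_against_density (@measurable_id _ _ setT) mf0 f0_ge0 nuE mg eg0).
Qed.

Lemma mean_fast_exit_ratio b : 0 < b -> mean nu (fast_exit_ratio b) = 1.
Proof.
move=> b0; have b0' := ltW b0; apply: EFin_inj; rewrite mean_against_density.
- rewrite -(integral_fast_exit_density T_gt0 gammaP theta0P beta0_gt0 b0).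
  by apply: eq_integral => x _; rewrite fast_exit_ratioK.
- exact: bounded_measurable_fast_exit_ratio.
- by move=> x; exact: fast_exit_ratio_ge0.
Qed.

Lemma mean_fast_exit_ratio_sqr b : 0 < b ->
  b / (2 * alpha0 j0 * beta0 j0) * (1 - expR (- (2 * b * T))) <=
  mean nu (fun x => fast_exit_ratio b x ^+ 2).
Proof.
move=> b0; have b0' := ltW b0; rewrite -lee_fin mean_against_density.
- apply: (le_trans (fast_exit_second_moment T_gt0 gammaP theta0P alpha0_gt0
    beta0_gt0 b0)).
  rewrite le_eqVlt; apply/predU1P; left; apply: eq_integral => x _.
  by rewrite expr2 -[in RHS]mulrA fast_exit_ratioK.
- by apply: (@bounded_measurableM _ _ _ (fast_exit_ratio b));
    exact: bounded_measurable_fast_exit_ratio.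
- by move=> x; exact: sqr_ge0.
Qed.

Lemma cvg_mean_fast_exit_ratio_sqr :
  mean nu (fun x => fast_exit_ratio k.+1%:R x ^+ 2) @[k --> \oo] --> +oo.
Proof.
pose c := (1 - expR (- (2 * T))) / (2 * alpha0 j0 * beta0 j0).
have c0 : 0 < c.
  rewrite divr_gt0 ?mulr_gt0// subr_gt0 -[ltRHS]expR0 ltr_expR oppr_lt0.
  by rewrite mulr_gt0.
apply/cvgryPge => A; near=> k.
have Ak : A / c <= k.+1%:R.
  rewrite (@le_trans _ _ k%:R) ?ler_nat//; near: k; exact: nbhs_infty_ger.
apply: le_trans (mean_fast_exit_ratio_sqr (ltr0Sn _ k)).
move: Ak; rewrite ler_pdivrMr// => /le_trans; apply.
rewrite /c mulrA mulrAC ler_wpM2l//; last first.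
  rewrite lerD2l lerN2 ler_expR lerN2 ler_wpM2r ?(ltW T_gt0)//.
  by rewrite ler_peMr// ler1n.
by rewrite divr_ge0// !mulr_ge0// ltW.
Unshelve. all: by end_near. Qed.

End fast_exit_ratio.

Theorem mainTheorem3 (R : realType) (w : nat) (T : R) (gamma0 : 'M[R]_w)
    (alpha0 beta0 : 'I_w -> R)
    (d : measure_display) (Omega : measurableType d) (P : probability Omega R)
    (X : nat -> {RV P >-> sample_path w R})
    (T_gt0 : 0 < T)
    (gamma0P : is_transition gamma0)
    (theta0P : is_param gamma0 (alpha0, beta0))
    (nondegenerate : exists j, 0 < alpha0 j /\ 0 < beta0 j)
    (X_indep : independent_seq X)
    (X_density : forall i, has_density (path_measure T) (X i)
       (path_density T gamma0 (alpha0, beta0)))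
    (M : R) (M_gt0 : 0 < M) :
  P [set omega | (loglik_ratio T gamma0 (alpha0, beta0) n (X ^~ omega) <= M%:E)%E]
    @[n --> \oo] --> 0%E.
Proof.
have [j0 [a0 b0]] := nondegenerate.
have w_gt0 : (0 < w)%N by apply: leq_trans (ltn_ord j0).
pose f0 := path_density T gamma0 (alpha0, beta0).
have f0_ge0 x : 0 <= f0 x by exact: is_param_density_ge0.
have mf0 : measurable_fun setT f0 by exact: measurable_path_density.
have X_id i A : measurable A -> distribution P (X i) A = distribution P (X 0) A.
  by move=> mA; rewrite !X_density.
pose r k := fast_exit_ratio T gamma0 alpha0 beta0 j0 k.+1%:R.
pose E n := [set omega |
  (loglik_ratio T gamma0 (alpha0, beta0) n (X ^~ omega) <= M%:E)%E].
have mE n : measurable (E n).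
  by apply: measurable_loglik_ratio_le => // i; exact: measurable_funP.
(* Observations of null density zero are discarded, so that the null likelihood
   may be cancelled. *)
pose N := \bigcup_i (f0 \o X i) @^-1` [set 0].
have mN0 i : measurable ((f0 \o X i) @^-1` [set 0]).
  rewrite -[_ @^-1` _]setTI; apply: measurableT_comp => //.
have mN : measurable N by exact: bigcupT_measurable.
have PN : P N = 0%E.
  apply: measure_negligible => //; apply: negligible_bigcup => i.
  exists ((f0 \o X i) @^-1` [set 0]); split => //.
  have m0 : measurable (f0 @^-1` [set 0]).
    by rewrite -[_ @^-1` _]setTI; exact: mf0.
  have := X_density i _ m0; rewrite /distribution/pushforward/= => ->.
  by apply: integral0_eq => x fx; congr EFin; exact: fx.
have PE n : P (E n) = P (E n `\` N).
  rewrite (measureDI P (mE n) mN) -[RHS]adde0; congr (_ + _)%E.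
  by rewrite (subset_measure0 _ _ _ PN)//; exact: measurableI.
suff : P (E n `\` N) @[n --> \oo] --> 0%E by under eq_cvg do rewrite -PE.
apply: (mixture_divergence X_indep X_id (r := r) (M := M)).
- by move=> k; exact: bounded_measurable_fast_exit_ratio.
- by move=> k u; exact: fast_exit_ratio_ge0.
- by move=> k; apply: mean_fast_exit_ratio => // A mA; exact: X_density.
- by apply: cvg_mean_fast_exit_ratio_sqr => // A mA; exact: X_density.
- by move=> n; exact: measurableD.
move=> n omega [/(loglik_ratio_leP _ _ _ _ theta0P) EM NX] k p p01.
have f0_gt0 i : 0 < f0 (X i omega).
  by rewrite lt_def f0_ge0 andbT; apply/eqP => f00; apply: NX; exists i.
have thetaP := fast_exit_paramP gamma0P theta0P b0 (ler0n R k.+1).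
have F0 : 0 < null_lik T gamma0 (alpha0, beta0) n (X ^~ omega).
  exact: prodr_gt0.
rewrite -(ler_pM2r F0); apply: le_trans (EM p _ p01 thetaP).
rewrite /null_lik /mixture_lik -big_split/=.
have [p0 p1] := andP p01.
apply: ler_prod => i _; apply/andP; split.
  apply: mulr_ge0; last exact: f0_ge0.
  apply: addr_ge0; first by rewrite subr_ge0.
  by apply: mulr_ge0 => //; exact: fast_exit_ratio_ge0.
rewrite mulrDl lerD2l -mulrA ler_wpM2l// fast_exit_ratioK//.
exact: fast_exit_density_le.
Qed.
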